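(* Let $k\ge 1$ be fixed. For all sufficiently large $m$, if $G$ is a $k$-planar graph with $m$ edges, then $\lambda(G)\le\lambda(S_{2,m})$, with equality if and only if $G=S_{2,m}$.
   Context: All graphs are finite and simple; isolated vertices are ignored. A graph is $k$-planar if it has a drawing in the plane in which each edge is crossed by at most $k$ other edges. Split graph: write $m-1=2t+s$ with $t\ge 1$ and $s\in\{0,1\}$; $S_{2,m}$ is the $m$-edge graph obtained from $K_2\vee tK_1$ (an edge joined to $t$ independent vertices) by adding one extra vertex adjacent to exactly $s$ of the two vertices of the $K_2$. $\lambda(G)$ is the spectral radius of the adjacency matrix. *)

(* Defs.v *)
From HB Require Import structures.
From mathcomp Require Import all_boot all_order all_algebra.
From mathcomp Require Import all_classical all_reals all_analysis.
From mathcomp.real_closed Require Import polyrcf.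
Set Implicit Arguments. Unset Strict Implicit. Unset Printing Implicit Defensive.
Import Order.TTheory GRing.Theory Num.Theory.
Import numFieldNormedType.Exports.
Local Open Scope ring_scope.

(* A finite simple graph is a symmetric irreflexive relation e on a finType T.
   Edges are the 2-element vertex sets {x,y} with e x y. *)
Definition edge_set (T : finType) (e : rel T) : {set {set T}} :=
  [set E : {set T} | [exists x, exists y, e x y && (E == [set x; y])]].

Definition adj_mx (R : nzRingType) (T : finType) (e : rel T) : 'M[R]_#|T| :=
  \matrix_(i, j) (e (enum_val i) (enum_val j))%:R.

(* Spectral radius of a real matrix: the largest absolute value of a real
   eigenvalue (= real root of the characteristic polynomial).  For symmetric
   matrices (adjacency matrices) all eigenvalues are real, so this is the
   usual spectral radius. *)
Definition spec_rad (R : rcfType) (n : nat) (A : 'M[R]_n) : R :=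
  \big[Num.max/0]_(a <- rootsR (char_poly A)) `|a|.

Definition lambda (R : rcfType) (T : finType) (e : rel T) : R :=
  spec_rad (adj_mx R e).

(* m - 1 = 2t + s, t = (m-1)/2, s = (m-1) mod 2.  Vertices 'I_(t+2+s):
   0 and 1 form the K_2, 2..t+1 are the t independent vertices joined to both,
   and (if s = 1) vertex t+2 is adjacent to vertex 0 only. *)
Definition S2_t (m : nat) : nat := (m.-1)./2.
Definition S2_s (m : nat) : nat := odd m.-1.
Definition S2_vert (m : nat) : finType := 'I_(S2_t m + 2 + S2_s m).

Definition S2_lt (m : nat) (i j : nat) : bool :=
  [|| (i == 0%N) && (j == 1%N),
      (i <= 1)%N && (2 <= j)%N && (j < S2_t m + 2)%N
    | [&& i == 0%N, j == (S2_t m + 2)%N & S2_s m == 1%N]].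

Definition S2_rel (m : nat) : rel (S2_vert m) :=
  fun i j => S2_lt m i j || S2_lt m j i.

Definition isolated (T : finType) (e : rel T) (x : T) : bool := [forall y, ~~ e x y].

(* G (on T) equals H (on U) after deleting isolated vertices: there is an
   injection f from the non-isolated vertices of H onto the non-isolated
   vertices of G preserving and reflecting adjacency. *)
Definition iso_ni (T U : finType) (e : rel T) (h : rel U) : Prop :=
  exists f : U -> T,
    [/\ {in [pred u | ~~ isolated h u] &, injective f},
        (forall u, ~~ isolated h u -> ~~ isolated e (f u)),
        (forall x, ~~ isolated e x -> exists2 u, ~~ isolated h u & f u = x)
      & {in [pred u | ~~ isolated h u] &, forall u v, e (f u) (f v) = h u v}].

Definition unit_itv (R : realType) : set R := [set t | (0 <= t <= 1)%R]%classic.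
Definition open_unit_itv (R : realType) : set R := [set t | (0 < t < 1)%R]%classic.

Definition is_drawing (R : realType) (T : finType) (e : rel T)
  (pos : T -> R * R) (c : {set T} -> R -> R * R) : Prop :=
  injective pos /\
  forall x y, e x y ->
    let E := [set x; y] in
    [/\ {within @unit_itv R, continuous (c E)}%classic,
        (forall s t, unit_itv s -> unit_itv t -> c E s = c E t -> s = t),
        (c E 0%R = pos x /\ c E 1%R = pos y) \/ (c E 0%R = pos y /\ c E 1%R = pos x)
      & (forall t z, open_unit_itv t -> c E t <> pos z)].

Definition crossing (R : realType) (T : finType) (c : {set T} -> R -> R * R)
  (E F : {set T}) : Prop :=
  exists s t, open_unit_itv s /\ open_unit_itv t /\ c E s = c F t.

Definition k_planar (R : realType) (k : nat) (T : finType) (e : rel T) : Prop :=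
  exists (pos : T -> R * R) (c : {set T} -> R -> R * R), is_drawing e pos c /\
    forall E, E \in edge_set e ->
      forall S : {set {set T}},
        (forall F, F \in S -> [/\ F \in edge_set e, F != E & crossing c E F]) ->
        (#|S| <= k)%N.

Arguments lambda R {T} e.
Arguments k_planar R k {T} e.
Arguments S2_rel m : clear implicits.

(* Main.v *)
Require Import Defs.
From HB Require Import structures.
From mathcomp Require Import all_boot all_order all_algebra.
From mathcomp Require Import all_classical all_reals all_analysis.
From mathcomp.real_closed Require Import polyrcf.
From mathcomp Require Import zify ring lra.
Set Implicit Arguments. Unset Strict Implicit. Unset Printing Implicit Defensive.
Import Order.TTheory GRing.Theory Num.Theory.
Import numFieldNormedType.Exports.
Local Open Scope ring_scope.

(** The only consequence of k-planarity that is needed is the absence of a large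
    K_{3,r}.  Among many common neighbours of three vertices one finds three whose
    stars do not cross each other (edges of the same star may), and then the
    independent edges of a K_{3,3} are pairwise disjoint compact paths.  This is
    impossible: for disjoint paths p and q the direction of p(s) - q(t) winds zero
    times around the boundary of the square of parameters (s, t), and these relations
    contradict each other modulo 8 because direction is antipodal under exchanging
    the two points.

    Let y be the absolute value of an eigenvector for the spectral radius theta,
    scaled to have maximum 1 at u, and suppose that theta^2 - theta >= m - 3/2, as
    holds for S_{2,m}.  Counting walks of length two and using that there is no
    K_{3,r}, every vertex with y bounded below has degree linear in m, so there are
    boundedly many of them; then either u has almost m neighbours, or u has almost
    m/2 common neighbours with some v with y v close to 1.  The first case
    contradicts theta^2 > m.  In the second case, comparing theta^2 (y u + y v) with
    the number of edges leaves room for the edge uv and at most one pendant edge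
    besides the common neighbours, so the graph is S_{2,m}. *)

(** * Winding of discrete paths *)

(** The representative of [b - a] modulo 4 in -1, 0, 1: the signed number of quarter turns between
    quadrants, meaningful when they are not opposite. *)
Definition turn (a b : int) : int :=
  if b - a == 3 then -1 else if b - a == -3 then 1 else b - a.

Definition quarter (a : int) : Prop := 0 <= a /\ a < 4.
Definition non_opposite (a b : int) : Prop := b - a <> 2 /\ b - a <> -2.

(** Pairwise non-opposite quadrants take at most two, adjacent, values, so no full turn can be
    picked up. *)
Lemma turn_add (a b c : int) : quarter a -> quarter b -> quarter c ->
  non_opposite a b -> non_opposite b c -> non_opposite a c ->
  turn a b + turn b c = turn a c.
Proof.
rewrite /quarter /non_opposite /turn => qa qb qc ab bc ac.
by repeat case: eqP => ?; lia.
Qed.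

Definition path_turn (f : nat -> int) (n : nat) : int :=
  \sum_(k < n) turn (f k) (f k.+1).

Lemma path_turn0 (f : nat -> int) : path_turn f 0 = 0.
Proof. by rewrite /path_turn big_ord0. Qed.

Lemma path_turnS (f : nat -> int) (n : nat) :
  path_turn f n.+1 = path_turn f n + turn (f n) (f n.+1).
Proof. by rewrite /path_turn big_ord_recr. Qed.

Lemma path_turn_mod4 (f : nat -> int) (n : nat) :
  exists z : int, path_turn f n = f n - f 0%N + 4 * z.
Proof.
elim: n => [|n [z IH]]; first by exists 0; rewrite path_turn0; lia.
rewrite path_turnS IH /turn.
by do 2?case: eqP => ?; [exists (z - 1)|exists (z + 1)|exists z]; lia.
Qed.

(** A discrete homotopy: both routes around a unit cell have the turn of its diagonal by [turn_add],
    and the cells are summed to strips, the strips to the rectangle. *)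
Lemma grid_turn (F : nat -> nat -> int) (n m : nat) :
  (forall k l, quarter (F k l)) ->
  (forall k l k' l', (k <= k' <= k.+1)%N -> (l <= l' <= l.+1)%N ->
     (k' <= n)%N -> (l' <= m)%N -> non_opposite (F k l) (F k' l')) ->
  path_turn (F^~ 0%N) n + path_turn (F n) m =
  path_turn (F 0%N) m + path_turn (F^~ m) n.
Proof.
move=> q no.
have cell k l : (k < n)%N -> (l < m)%N ->
    turn (F k l) (F k.+1 l) + turn (F k.+1 l) (F k.+1 l.+1) =
    turn (F k l) (F k l.+1) + turn (F k l.+1) (F k.+1 l.+1).
  by move=> kn lm; rewrite !turn_add //; apply: no; lia.
have strip l p : (l < m)%N -> (p <= n)%N ->
    path_turn (F^~ l) p + turn (F p l) (F p l.+1) =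
    turn (F 0%N l) (F 0%N l.+1) + path_turn (F^~ l.+1) p.
  move=> lm; elim: p => [|p IH] pn; first by rewrite !path_turn0 add0r addr0.
  move: (IH (ltnW pn)) (cell p l pn lm).
  by rewrite !path_turnS /=; lia.
suff H p : (p <= m)%N -> path_turn (F^~ 0%N) n + path_turn (F n) p =
    path_turn (F 0%N) p + path_turn (F^~ p) n by exact: H.
elim: p => [|p IH] pm; first by rewrite !path_turn0 add0r addr0.
move: (IH (ltnW pm)) (strip p n pm (leqnn n)).
by rewrite !path_turnS /=; lia.
Qed.

(** * Quadrants of plane vectors *)

Section Sector.
Variable R : realDomainType.
Implicit Types (p q : R * R) (eps : R).

(* The quadrant of a nonzero vector, numbered counterclockwise; 3 at the origin. *)
Definition sector p : int :=
  if (0 < p.1) && (0 <= p.2) then 0 else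
  if (p.1 <= 0) && (0 < p.2) then 1 else
  if (p.1 < 0) && (p.2 <= 0) then 2 else 3.

Definition away eps p : Prop := eps <= `|p.1| \/ eps <= `|p.2|.
Definition box_close eps p q : Prop := `|p.1 - q.1| < eps /\ `|p.2 - q.2| < eps.

Lemma quarter_sector p : quarter (sector p).
Proof. by rewrite /quarter /sector; repeat case: ifP. Qed.

Lemma sectorP p : [/\ sector p = 3, p.1 = 0 & p.2 = 0] \/ [\/ [/\ sector p = 0, 0 < p.1 & 0 <= p.2],
  [/\ sector p = 1, p.1 <= 0 & 0 < p.2], [/\ sector p = 2, p.1 < 0 & p.2 <= 0]
  | [/\ sector p = 3, 0 <= p.1 & p.2 < 0]].
Proof.
rewrite /sector; case: (ltrgtP p.1 0) => h1; case: (ltrgtP p.2 0) => h2 /=;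
by first [left; split=> //; lra
  | right; constructor 1; split=> //; lra | right; constructor 2; split=> //; lra
  | right; constructor 3; split=> //; lra | right; constructor 4; split=> //; lra].
Qed.

(** A coordinate of size at least [eps] keeps its sign under a change below [eps], whereas between
    opposite quadrants no coordinate keeps a nonzero sign. *)
Lemma non_opposite_sector eps p q :
  away eps p -> box_close eps p q -> non_opposite (sector p) (sector q).
Proof.
move=> ap [/ltr_normlP[c1 c2] /ltr_normlP[c3 c4]]; rewrite /non_opposite.
have {}ap : [\/ eps <= p.1, eps <= - p.1, eps <= p.2 | eps <= - p.2].
  case: ap => h; move: h; case: (ler0P _) => _ h;
  [constructor 2|constructor 1|constructor 4|constructor 3]; exact: h.
case: (sectorP p) => [[-> p1 p2]|[][-> p1 p2]]; case: (sectorP q) => [[-> q1 q2]|[][-> q1 q2]];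
  by (split; (by []) || (case: ap => ?; exfalso; lra)).
Qed.

Lemma away_neq0 eps p : 0 < eps -> away eps p -> p.1 != 0 \/ p.2 != 0.
Proof.
move=> e0 [h|h]; [left|right]; rewrite -normr_gt0; exact: lt_le_trans h.
Qed.

Lemma sector_opp p : p.1 != 0 \/ p.2 != 0 ->
  exists z : int, sector p - sector (- p.1, - p.2) = 2 + 4 * z.
Proof.
move=> h; have h' : ~ (p.1 = 0 /\ p.2 = 0) by case: h => /eqP + [].
case: (sectorP p) => [[-> p1 p2]|[][-> p1 p2]];
 case: (sectorP (- p.1, - p.2)) => [[-> q1 q2]|[][-> q1 q2]];
 move: q1 q2 => /= q1 q2; first [by exists 0|by exists (-1)|exfalso];
 by (lra || (apply: h'; split; lra)).
Qed.

End Sector.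

(** Negation shifts both quadrants by 2 modulo 4, and for non-opposite quadrants the turn depends
    only on their difference modulo 4. *)
Lemma turn_sector_opp (R : realDomainType) (eps : R) (p q : R * R) : 0 < eps ->
  away eps p -> away eps q -> box_close eps p q ->
  turn (sector (- p.1, - p.2)) (sector (- q.1, - q.2)) = turn (sector p) (sector q).
Proof.
move=> e0 ap aq cpq.
have [z hz] := sector_opp (away_neq0 e0 ap); have [z' hz'] := sector_opp (away_neq0 e0 aq).
have no := non_opposite_sector ap cpq.
move: (quarter_sector p) (quarter_sector q) (quarter_sector (- p.1, - p.2))
  (quarter_sector (- q.1, - q.2)) no hz hz'.
rewrite /quarter /non_opposite /turn => qp qq qp' qq' no hz hz'.
by repeat case: eqP => ?; lia.
Qed.

(* Summing the boundary relation of the cells e x f over the 18 unordered pairs of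
   independent edges of K_{3,3} counts every winding number twice, so modulo 8 only
   the antipodal defects sector p - sector (- p) remain, and these add up to 4. *)
Lemma K33_parity (AA AB BA BB : nat -> nat -> int) (DA DB : nat -> nat -> nat -> int) :
  (forall i j i', (i < 3)%N -> (j < 3)%N -> (i' < 3)%N -> i != i' ->
     exists z, DA i j i' = BA j i' - AA i i' + 4 * z) ->
  (forall i j j', (i < 3)%N -> (j < 3)%N -> (j' < 3)%N -> j != j' ->
     exists z, DB i j j' = BB j j' - AB i j' + 4 * z) ->
  (forall i i', (i < 3)%N -> (i' < 3)%N -> i != i' -> exists z, AA i i' - AA i' i = 2 + 4 * z) ->
  (forall j j', (j < 3)%N -> (j' < 3)%N -> j != j' -> exists z, BB j j' - BB j' j = 2 + 4 * z) ->
  (forall i j, (i < 3)%N -> (j < 3)%N -> exists z, AB i j - BA j i = 2 + 4 * z) ->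
  (forall i j i' j', (i < 3)%N -> (j < 3)%N -> (i' < 3)%N -> (j' < 3)%N ->
     i != i' -> j != j' -> DA i j i' + DB i' j' j = DB i j j' + DA i' j' i) ->
  False.
Proof.
move=> hA hB hAA hBB hAB cell.
pose c i j i' j' := DA i j i' + DB i' j' j - DB i j j' - DA i' j' i.
have c0 i j i' j' : (i < 3)%N -> (j < 3)%N -> (i' < 3)%N -> (j' < 3)%N ->
    i != i' -> j != j' -> c i j i' j' = 0.
  by move=> *; rewrite /c cell //; lia.
have : c 0 0 1 1 + c 0 0 1 2 + c 0 1 1 0 + c 0 1 1 2 + c 0 2 1 0 + c 0 2 1 1 +
    c 0 0 2 1 + c 0 0 2 2 + c 0 1 2 0 + c 0 1 2 2 + c 0 2 2 0 + c 0 2 2 1 +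
    c 1 0 2 1 + c 1 0 2 2 + c 1 1 2 0 + c 1 1 2 2 + c 1 2 2 0 + c 1 2 2 1 = 0.
  by rewrite !c0.
rewrite /c.
have [a001 ->] := hA 0 0 1 isT isT isT isT; have [a002 ->] := hA 0 0 2 isT isT isT isT.
have [b001 ->] := hB 0 0 1 isT isT isT isT; have [b002 ->] := hB 0 0 2 isT isT isT isT.
have [a011 ->] := hA 0 1 1 isT isT isT isT; have [a012 ->] := hA 0 1 2 isT isT isT isT.
have [b010 ->] := hB 0 1 0 isT isT isT isT; have [b012 ->] := hB 0 1 2 isT isT isT isT.
have [a021 ->] := hA 0 2 1 isT isT isT isT; have [a022 ->] := hA 0 2 2 isT isT isT isT.
have [b020 ->] := hB 0 2 0 isT isT isT isT; have [b021 ->] := hB 0 2 1 isT isT isT isT.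
have [a100 ->] := hA 1 0 0 isT isT isT isT; have [a102 ->] := hA 1 0 2 isT isT isT isT.
have [b101 ->] := hB 1 0 1 isT isT isT isT; have [b102 ->] := hB 1 0 2 isT isT isT isT.
have [a110 ->] := hA 1 1 0 isT isT isT isT; have [a112 ->] := hA 1 1 2 isT isT isT isT.
have [b110 ->] := hB 1 1 0 isT isT isT isT; have [b112 ->] := hB 1 1 2 isT isT isT isT.
have [a120 ->] := hA 1 2 0 isT isT isT isT; have [a122 ->] := hA 1 2 2 isT isT isT isT.
have [b120 ->] := hB 1 2 0 isT isT isT isT; have [b121 ->] := hB 1 2 1 isT isT isT isT.
have [a200 ->] := hA 2 0 0 isT isT isT isT; have [a201 ->] := hA 2 0 1 isT isT isT isT.
have [b201 ->] := hB 2 0 1 isT isT isT isT; have [b202 ->] := hB 2 0 2 isT isT isT isT.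
have [a210 ->] := hA 2 1 0 isT isT isT isT; have [a211 ->] := hA 2 1 1 isT isT isT isT.
have [b210 ->] := hB 2 1 0 isT isT isT isT; have [b212 ->] := hB 2 1 2 isT isT isT isT.
have [a220 ->] := hA 2 2 0 isT isT isT isT; have [a221 ->] := hA 2 2 1 isT isT isT isT.
have [b220 ->] := hB 2 2 0 isT isT isT isT; have [b221 ->] := hB 2 2 1 isT isT isT isT.
have [p01 ?] := hAA 0 1 isT isT isT; have [q01 ?] := hBB 0 1 isT isT isT.
have [p02 ?] := hAA 0 2 isT isT isT; have [q02 ?] := hBB 0 2 isT isT isT.
have [p12 ?] := hAA 1 2 isT isT isT; have [q12 ?] := hBB 1 2 isT isT isT.
have [r00 ?] := hAB 0 0 isT isT; have [r01 ?] := hAB 0 1 isT isT.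
have [r02 ?] := hAB 0 2 isT isT; have [r10 ?] := hAB 1 0 isT isT.
have [r11 ?] := hAB 1 1 isT isT; have [r12 ?] := hAB 1 2 isT isT.
have [r20 ?] := hAB 2 0 isT isT; have [r21 ?] := hAB 2 1 isT isT.
have [r22 ?] := hAB 2 2 isT isT.
lia.
Qed.

Lemma box_close_sub (R : realDomainType) (eps : R) (p p' q q' : R * R) :
  0 < eps -> p = p' \/ box_close eps p p' -> q = q' \/ box_close eps q q' ->
  box_close (eps + eps) (p.1 - q.1, p.2 - q.2) (p'.1 - q'.1, p'.2 - q'.2).
Proof.
move=> e0 cp cq; split=> /=.
  have h1 : `|p.1 - p'.1| < eps by case: cp => [->|[]//]; rewrite subrr normr0.
  have h2 : `|q.1 - q'.1| < eps by case: cq => [->|[]//]; rewrite subrr normr0.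
  move: h1 h2 => /ltr_normlP[? ?] /ltr_normlP[? ?]; apply/ltr_normlP; split; lra.
have h1 : `|p.2 - p'.2| < eps by case: cp => [->|[]//]; rewrite subrr normr0.
have h2 : `|q.2 - q'.2| < eps by case: cq => [->|[]//]; rewrite subrr normr0.
move: h1 h2 => /ltr_normlP[? ?] /ltr_normlP[? ?]; apply/ltr_normlP; split; lra.
Qed.

(** Along two independent edges the points stay [eps + eps] apart, while one step on each changes
    their difference by less. So their directions form a grid to which [grid_turn] applies, and its
    boundary relation is the cell hypothesis of [K33_parity]. *)
Lemma no_discrete_K33 (R : realDomainType) (eps : R) (n : nat)
    (g : nat -> nat -> nat -> R * R) (a b : nat -> R * R) :
  0 < eps ->
  (forall i j, (i < 3)%N -> (j < 3)%N -> g i j 0%N = a i /\ g i j n = b j) ->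
  (forall i j k, (i < 3)%N -> (j < 3)%N -> (k < n)%N ->
     box_close eps (g i j k) (g i j k.+1)) ->
  (forall i j i' j' k l, (i < 3)%N -> (j < 3)%N -> (i' < 3)%N -> (j' < 3)%N ->
     i != i' -> j != j' -> (k <= n)%N -> (l <= n)%N ->
     away (eps + eps) ((g i j k).1 - (g i' j' l).1, (g i j k).2 - (g i' j' l).2)) ->
  False.
Proof.
move=> e0 ends steps sep.
have e20 : 0 < eps + eps by lra.
pose dir (p q : R * R) : int := sector (p.1 - q.1, p.2 - q.2).
have dirN p q : dir q p = sector (- (p.1 - q.1, p.2 - q.2).1, - (p.1 - q.1, p.2 - q.2).2).
  by rewrite /dir /= !opprB.
have dir_opp p q : away (eps + eps) (p.1 - q.1, p.2 - q.2) ->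
    exists z, dir p q - dir q p = 2 + 4 * z.
  by move=> h; rewrite (dirN p q); apply: sector_opp; exact: away_neq0 e20 h.
have ga i j : (i < 3)%N -> (j < 3)%N -> g i j 0%N = a i by move=> *; case: (ends i j).
have gb i j : (i < 3)%N -> (j < 3)%N -> g i j n = b j by move=> *; case: (ends i j).
have other i : (i < 3)%N -> exists i', (i' < 3)%N /\ i' != i.
  by case: i => [|i] _; [exists 1%N|exists 0%N].
pose DA i j i' := path_turn (fun k => dir (g i j k) (a i')) n.
pose DB i j j' := path_turn (fun k => dir (g i j k) (b j')) n.
apply: (@K33_parity (fun i i' => dir (a i) (a i')) (fun i j => dir (a i) (b j))
  (fun j i => dir (b j) (a i)) (fun j j' => dir (b j) (b j')) DA DB).
- move=> i j i' ? ? ? _; rewrite -(gb i j) // -(ga i j) //.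
  have [z hz] := path_turn_mod4 (fun k => dir (g i j k) (a i')) n.
  by exists z; rewrite -hz.
- move=> i j j' ? ? ? _; rewrite -(gb i j) // -(ga i j) //.
  have [z hz] := path_turn_mod4 (fun k => dir (g i j k) (b j')) n.
  by exists z; rewrite -hz.
- move=> i i' ? ? ii'; apply: dir_opp; rewrite -(ga i 0%N) // -(ga i' 1%N) //.
  exact: sep.
- move=> j j' ? ? jj'; apply: dir_opp; rewrite -(gb 0%N j) // -(gb 1%N j') //.
  exact: sep.
- move=> i j i3 j3; apply: dir_opp.
  (* [sep] speaks of independent edges only, so [a i] and [b j] are viewed as ends of the edges
     [(i, j')] and [(i', j)]. *)
  have [i' [? ii']] := other i i3; have [j' [? jj']] := other j j3.
  by rewrite -(ga i j') // -(gb i' j) //; apply: sep; rewrite // eq_sym.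
move=> i j i' j' i3 j3 i'3 j'3 ii' jj'.
pose F k l := dir (g i j k) (g i' j' l).
have hF : path_turn (F^~ 0%N) n + path_turn (F n) n =
    path_turn (F 0%N) n + path_turn (F^~ n) n.
  apply: grid_turn => [k l|k l k' l' hk hl k'n l'n]; first exact: quarter_sector.
  apply: (@non_opposite_sector _ (eps + eps)); first by apply: sep => //; lia.
  apply: box_close_sub => //.
    have [?|?] : k' = k \/ k' = k.+1 by lia.
      by left; subst k'.
    by right; subst k'; apply: steps => //; lia.
  have [?|?] : l' = l \/ l' = l.+1 by lia.
    by left; subst l'.
  by right; subst l'; apply: steps => //; lia.
(* In [hF] the second edge is seen from a fixed end of the first, while [DA] and [DB] look from the
   moving point to the fixed one; the antipodal map preserves turns. *)
have flip p : (forall l, (l <= n)%N ->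
      away (eps + eps) (p.1 - (g i' j' l).1, p.2 - (g i' j' l).2)) ->
    path_turn (fun l => dir p (g i' j' l)) n = path_turn (fun l => dir (g i' j' l) p) n.
  move=> far; apply: eq_bigr => l _; rewrite !(dirN p) (@turn_sector_opp _ (eps + eps)) //.
  - by apply: far; exact: ltnW.
  - exact: far.
  - by apply: box_close_sub => //; [left|right; apply: steps].
move: hF; rewrite /F /= /DA /DB !ga // !gb // !flip //.
- by move=> ->; rewrite addrC.
- by move=> l ln; rewrite -(ga i j) //; exact: sep.
- by move=> l ln; rewrite -(gb i j) //; exact: sep.
Qed.

(** * Drawings of K_{3,r} *)

Section Paths.
Local Open Scope classical_set_scope.
Variable R : realType.
Implicit Types (f g : R -> R * R).

Lemma box_closeP (eps : R) (p q : R * R) : ball p eps q <-> box_close eps p q.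
Proof. by split => -[]. Qed.

Lemma compact_unit_itv : compact (@unit_itv R).
Proof.
have -> : @unit_itv R = `[0, 1]%classic by apply/seteqP; split=> t; rewrite /= in_itv.
exact: segment_compact.
Qed.

Lemma within_continuous_close f (s eps : R) :
  {within @unit_itv R, continuous f} -> unit_itv s -> 0 < eps ->
  exists2 r : R, 0 < r & forall t, unit_itv t -> `|s - t| < r -> box_close eps (f s) (f t).
Proof.
move=> /subspace_continuousP /(_ s) cf us e0.
have /fcvg_ballP := cf us.
move=> /(_ _ e0) /nbhs_ballP[r /= r0 hr].
exists r => // t ut st; exact: hr.
Qed.

Lemma box_close_trans (eps : R) (p q r : R * R) :
  box_close (eps / 2) p q -> box_close (eps / 2) p r -> box_close eps q r.
Proof.
move=> [/ltr_normlP[? ?] /ltr_normlP[? ?]] [/ltr_normlP[? ?] /ltr_normlP[? ?]].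
by split; apply/ltr_normlP; split; lra.
Qed.

(** Heine-Cantor, through the near-covering form of compactness with the modulus [d] tending to 0
    from the right. *)
Lemma unit_itv_uniform_continuous f (eps : R) :
  {within @unit_itv R, continuous f} -> 0 < eps ->
  exists2 d : R, 0 < d & forall s t, unit_itv s -> unit_itv t -> `|s - t| < d ->
    box_close eps (f s) (f t).
Proof.
move=> cf e0; have := compact_unit_itv.
move=> /compact_near_coveringP /near_covering_withinP.
move=> /(_ R (0^'+) (fun d s => forall t, unit_itv t -> `|s - t| < d ->
    box_close eps (f s) (f t)) _) [].
  move=> x ux.
  have [|r r0 hr] := within_continuous_close cf ux (_ : 0 < eps / 2); first by lra.
  have r20 : 0 < r / 2 by lra.
  exists (ball x (r / 2), [set d | d < r / 2]).
    split; first exact: nbhsx_ballx.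
    exact: nbhs_right_lt.
  move=> [s d] [/= xs dr] us t ut st.
  move: xs; rewrite /ball /= => xs.
  apply: (@box_close_trans _ (f x)); apply: hr => //; first lra.
  have := ler_distD s x t; lra.
move=> d /= d0 hd.
exists (d / 2); first by lra.
move=> s t us ut st; apply: (hd (d / 2)) => //=; rewrite ?sub0r ?normrN ?gtr0_norm; lra.
Qed.

(** The image of [g] is closed, so each point of the image of [f] has a ball avoiding it;
    compactness of the latter image makes the radius uniform. *)
Lemma disjoint_paths_away f g :
  {within @unit_itv R, continuous f} -> {within @unit_itv R, continuous g} ->
  (forall s t, unit_itv s -> unit_itv t -> f s <> g t) ->
  exists2 eps : R, 0 < eps & forall s t, unit_itv s -> unit_itv t ->
    away eps ((f s).1 - (g t).1, (f s).2 - (g t).2).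
Proof.
move=> cf cg fg.
have Kf := continuous_compact cf compact_unit_itv.
have /compact_closed clg := continuous_compact cg compact_unit_itv.
move: Kf => /compact_near_coveringP.
move=> /(_ R (0^'+) (fun d p => forall t, unit_itv t ->
    ~ box_close d p (g t)) _) [].
  move=> _ [s us <-].
  have : nbhs (f s) (~` (g @` @unit_itv R)).
    apply: open_nbhs_nbhs; split; first exact/closed_openC/clg/norm_hausdorff.
    by move=> [t ut gt]; exact: (fg s t).
  move=> /nbhs_ballP[r /= r0 hr].
  have r20 : 0 < r / 2 by lra.
  exists (ball (f s) (r / 2), [set d | d < r / 2]).
    split; first exact: nbhsx_ballx.
    exact: nbhs_right_lt.
  move=> [p d] [/= /box_closeP[c1 c2] dr] t ut [c3 c4].
  have /hr : ball (f s) r (g t).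
    apply/box_closeP; split.
      have := ler_distD p.1 (f s).1 (g t).1; lra.
    have := ler_distD p.2 (f s).2 (g t).2; lra.
  by apply; exists t.
move=> d /= d0 hd.
exists (d / 2); first by lra.
move=> s t us ut; have := hd (d / 2).
rewrite /= sub0r normrN gtr0_norm; last by lra.
move=> /(_ _ _ _ _ t ut) h.
have {}h : ~ box_close (d / 2) (f s) (g t).
  by apply: h; [lra|lra|exists s].
rewrite /away /=.
case: (lerP (d / 2) `|(f s).1 - (g t).1|) => h1; first by left.
case: (lerP (d / 2) `|(f s).2 - (g t).2|) => h2; first by right.
by case: h.
Qed.

Lemma within_continuous_reverse f :
  {within @unit_itv R, continuous f} ->
  {within @unit_itv R, continuous (fun t => f (1 - t))}.
Proof.
move=> /subspace_continuousP cf; apply/subspace_continuousP => x ux.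
have ux' : unit_itv (1 - x) by move: ux; rewrite /unit_itv /=; lra.
apply/fcvg_ballP => eps e0.
have /fcvg_ballP /(_ _ e0) /nbhs_ballP[r /= r0 hr] := cf _ ux'.
apply/nbhs_ballP; exists r => //= t xt ut; apply: hr.
  by move: xt; rewrite /ball /= distrC; congr (`|_| < _); lra.
by move: ut; rewrite /unit_itv /=; lra.
Qed.

Lemma common_pos (I : finType) (P : I -> R -> Prop) :
  (forall i d d', P i d -> d' <= d -> P i d') ->
  (forall i, exists2 d, 0 < d & P i d) -> exists2 d, 0 < d & forall i, P i d.
Proof.
move=> mono ex.
suff [d d0 hd] : exists2 d, 0 < d & forall i, i \in enum I -> P i d.
  by exists d => // i; apply: hd; rewrite mem_enum.
elim: (enum I) => [|i s [d d0 hd]]; first by exists 1.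
have [d' d'0 hd'] := ex i.
exists (Num.min d d'); first by rewrite lt_min d0.
move=> j; rewrite inE => /orP[/eqP->|/hd h].
  by apply: mono hd' _; rewrite ge_min lexx orbT.
by apply: mono h _; rewrite ge_min lexx.
Qed.

(** Finitely many paths share a separation [e] and a modulus [d] for [e / 2]; sampling at the
    multiples of [1 / n] with [1 / n < d] gives the discrete configuration excluded by
    [no_discrete_K33]. *)
Lemma K33_paths_meet (a b : 'I_3 -> R * R) (f : 'I_3 -> 'I_3 -> R -> R * R) :
  (forall i j, {within @unit_itv R, continuous (f i j)}) ->
  (forall i j, f i j 0 = a i /\ f i j 1 = b j) ->
  (forall i j i' j' s t, i != i' -> j != j' -> unit_itv s -> unit_itv t ->
     f i j s <> f i' j' t) -> False.
Proof.
move=> cf ends disj.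
have [e e0 he] : exists2 e : R, 0 < e & forall q : 'I_3 * 'I_3 * ('I_3 * 'I_3),
    q.1.1 != q.2.1 -> q.1.2 != q.2.2 -> forall s t, unit_itv s -> unit_itv t ->
    away e ((f q.1.1 q.1.2 s).1 - (f q.2.1 q.2.2 t).1,
            (f q.1.1 q.1.2 s).2 - (f q.2.1 q.2.2 t).2).
  apply: common_pos => [q d d' h dd' n1 n2 s t us ut|[[i j] [i' j']] /=].
    by case: (h n1 n2 s t us ut) => ?; [left|right]; lra.
  case: (eqVneq i i') => [_|ii']; first by exists 1.
  case: (eqVneq j j') => [_|jj']; first by exists 1.
  have [|d d0 hd] := disjoint_paths_away (cf i j) (cf i' j').
    by move=> s t; exact: disj.
  by exists d.
have e20 : 0 < e / 2 by lra.
have [d d0 hd] : exists2 d : R, 0 < d & forall q : 'I_3 * 'I_3,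
    forall s t, unit_itv s -> unit_itv t -> `|s - t| < d ->
    box_close (e / 2) (f q.1 q.2 s) (f q.1 q.2 t).
  apply: common_pos => [q d d' h dd' s t us ut st|q].
    by apply: h => //; lra.
  exact: unit_itv_uniform_continuous.
pose n := (Num.bound d^-1).+1.
have n0 : 0 < n%:R :> R by rewrite ltr0n.
have nd : n%:R^-1 < d.
  rewrite invf_plt ?posrE //.
  apply: lt_trans (archi_boundP _) _; first by rewrite invr_ge0 ltW.
  by rewrite ltr_nat.
have un k : (k <= n)%N -> unit_itv (k%:R / n%:R : R).
  move=> kn; rewrite /unit_itv /= divr_ge0 ?ler0n //=.
  by rewrite ler_pdivrMr // mul1r ler_nat.
pose g i j k := f (inord i) (inord j) (k%:R / n%:R).
have inj i i' : (i < 3)%N -> (i' < 3)%N -> i != i' -> inord i != inord i' :> 'I_3.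
  by move=> i3 i'3; apply: contraNneq => h; rewrite -(inordK i3) h inordK.
apply: (@no_discrete_K33 R (e / 2) n g (fun i => a (inord i)) (fun j => b (inord j))) => //.
- move=> i j _ _; rewrite /g mul0r divff ?gt_eqF //; exact: ends.
- move=> i j k _ _ kn; apply: (hd (inord i, inord j)); [exact/un/ltnW|exact: un|].
  rewrite -mulrBl -natr1 opprD addrA subrr add0r mulN1r normrN.
  by rewrite ger0_norm // invr_ge0 ltW.
- move=> i j i' j' k l i3 j3 i'3 j'3 ii' jj' kn ln.
  have -> : e / 2 + e / 2 = e by lra.
  by apply: (he (inord i, inord j, (inord i', inord j'))) => /=;
    [exact: inj|exact: inj|exact: un|exact: un].
Qed.

End Paths.

(** A drawing does not orient the curve of an edge; it is reversed when necessary so as to start at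
    [x]. *)
Lemma drawing_path (R : realType) (T : finType) (e : rel T) (pos : T -> R * R)
    (c : {set T} -> R -> R * R) (x y : T) : is_drawing e pos c -> e x y ->
  exists f : R -> R * R, [/\ {within @unit_itv R, continuous f}%classic,
    f 0 = pos x /\ f 1 = pos y,
    (forall t z, open_unit_itv t -> f t <> pos z)
    & (forall t, open_unit_itv t -> exists2 t', open_unit_itv t' & f t = c [set x; y] t')].
Proof.
move=> [_ /(_ x y)] h /h [cf _ ends int].
have rev t : open_unit_itv t -> @open_unit_itv R (1 - t).
  by rewrite /open_unit_itv /=; lra.
case: ends => ends; first by exists (c [set x; y]); split=> // t ?; exists t.
exists (fun t => c [set x; y] (1 - t)); split.
- exact: within_continuous_reverse.
- by rewrite subr0 subrr; case: ends.
- by move=> t z /rev; exact: int.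
- by move=> t /rev ?; exists (1 - t).
Qed.

Lemma crossing_sym (R : realType) (T : finType) (c : {set T} -> R -> R * R) (E F : {set T}) :
  crossing c E F -> crossing c F E.
Proof. by move=> [s [t [us [ut st]]]]; exists t, s. Qed.

Lemma unit_itvP (R : realType) (t : R) :
  unit_itv t -> [\/ t = 0, t = 1 | open_unit_itv t].
Proof.
rewrite /unit_itv /open_unit_itv /= => /andP[].
rewrite !le_eqVlt => /orP[/eqP<- _|h0 /orP[/eqP->|h1]]; first by constructor 1.
  by constructor 2.
by constructor 3; rewrite h0.
Qed.

(** Vertices have distinct positions and edge interiors avoid them, so two independent edges could
    meet only in a crossing of interiors. Crossings within a star are allowed here. *)
Lemma no_uncrossed_K33 (R : realType) (T : finType) (e : rel T) (pos : T -> R * R)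
    (c : {set T} -> R -> R * R) (h v : 'I_3 -> T) :
  is_drawing e pos c -> injective h -> injective v -> (forall i j, h i != v j) ->
  (forall i j, e (h i) (v j)) ->
  (forall i j i' j', i != i' -> j != j' -> ~ crossing c [set h i; v j] [set h i'; v j']) ->
  False.
Proof.
move=> dr hinj vinj hv ehv ncr.
pose good (q : 'I_3 * 'I_3) (f : R -> R * R) :=
  [/\ {within @unit_itv R, continuous f}%classic,
    f 0 = pos (h q.1) /\ f 1 = pos (v q.2),
    (forall t z, open_unit_itv t -> f t <> pos z)
    & (forall t, open_unit_itv t ->
         exists2 t', open_unit_itv t' & f t = c [set h q.1; v q.2] t')].
have [f hf] : {f & forall q, good q (f q)}.
  by apply: boolp.choice => q; exact: (drawing_path dr).
apply: (@K33_paths_meet R (pos \o h) (pos \o v) (fun i j => f (i, j))).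
- by move=> i j; case: (hf (i, j)).
- by move=> i j; case: (hf (i, j)).
move=> i j i' j' s t ii' jj' us ut.
have [_ [/= a0 a1] an ac] := hf (i, j); have [_ [/= b0 b1] bn bc] := hf (i', j').
have posinj := dr.1.
case: (unit_itvP us) => [->|->|os]; case: (unit_itvP ut) => [->|->|ot];
  rewrite ?a0 ?a1 ?b0 ?b1.
- by move=> /posinj/hinj/eqP; apply/negP.
- by move=> /posinj/eqP; apply/negP.
- by move=> /esym; exact: bn.
- by move=> /posinj/esym/eqP; apply/negP.
- by move=> /posinj/vinj/eqP; apply/negP.
- by move=> /esym; exact: bn.
- exact: an.
- exact: an.
move=> E; have [s' os' Es] := ac _ os; have [t' ot' Et] := bc _ ot.
by apply: (ncr i j i' j') => //; exists s', t'; rewrite -Es -Et.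
Qed.

(** Three common neighbours are picked greedily, each with a star not crossing the earlier stars
    except possibly along edges to the same vertex; they would form the configuration of
    [no_uncrossed_K33]. *)
Lemma k_planar_codegree3 (R : realType) (k : nat) (T : finType) (e : rel T) (x y z : T) :
  irreflexive e -> k_planar R k e -> x != y -> x != z -> y != z ->
  (#|[set v | [&& e x v, e y v & e z v]]| < 18 * k + 3)%N.
Proof.
move=> eirr [pos [c [dr cross]]] xy xz yz; rewrite ltnNge; apply/negP.
set C := [set v | _] => cardC.
pose h (i : 'I_3) := nth x [:: x; y; z] i.
have hinj : injective h.
  move=> i j /eqP; rewrite nth_uniq //= ?inE ?negb_or ?xy ?xz ?yz //.
  by move=> /eqP/val_inj.
have Ce i v : v \in C -> e (h i) v.
  by rewrite inE => /and3P[? ? ?]; case: i => -[|[|[|]]].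
have edge i v : v \in C -> [set h i; v] \in edge_set e.
  move=> /(Ce i) hv; rewrite inE; apply/existsP; exists (h i); apply/existsP; exists v.
  by rewrite hv eqxx.
pose A E := [set F in edge_set e | (F != E) && `[< crossing c E F >]].
have cA E : E \in edge_set e -> (#|A E| <= k)%N.
  move=> hE; apply: (cross E hE) => F; rewrite inE => /and3P[? ? /asboolP ?]; split=> //.
(* For each of the 9 choices of two centres, at most [k] edges cross the given edge at [v], whence
   at most [9 * k] bad vertices. *)
pose bad v := \bigcup_(q : 'I_3 * 'I_3) [set w in C | [set h q.2; w] \in A [set h q.1; v]].
have cbad v : v \in C -> (#|bad v| <= 9 * k)%N.
  move=> vC.
  have -> : (9 * k = \sum_(q : 'I_3 * 'I_3) k)%N.
    by rewrite sum_nat_const card_prod card_ord mulnC.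
  apply: (big_ind2 (fun (B : {set T}) n => (#|B| <= n)%N)) => [|B n B' n' Bn Bn'|].
  - by rewrite cards0.
  - exact: leq_trans (leq_card_setU _ _) (leq_add Bn Bn').
  move=> [i i'] _ /=; apply: leq_trans (cA _ (edge i v vC)).
  have inj : {in [set w in C | [set h i'; w] \in A [set h i; v]] &,
      injective (fun w => [set h i'; w])}.
    move=> w w'; rewrite finset.in_set => /andP[wC _] _ /setP /(_ w).
    rewrite !inE eqxx orbT => /esym /orP[|/eqP //] /eqP E.
    by move: (Ce i' w wC) ; rewrite E eirr.
  rewrite -(card_in_imset inj); apply: subset_leq_card.
  by apply/fintype.subsetP => _ /imsetP[w + ->]; rewrite finset.in_set => /andP[].
have pick (B : {set T}) : (#|B| < #|C|)%N -> exists2 w, w \in C & w \notin B.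
  move=> lt; case: (boolP (C \subset B)) => [/subset_leq_card|/fintype.subsetPn//].
  by rewrite leqNgt lt.
have [v0 v0C _] : exists2 w, w \in C & w \notin finset.set0.
  by apply: pick; rewrite cards0; lia.
have [v1 v1C] : exists2 w, w \in C & w \notin v0 |: bad v0.
  by apply: pick; rewrite cardsU1; have := cbad v0 v0C; lia.
rewrite finset.in_setU1 negb_or => /andP[v10 bad01].
(* At most [18 * k + 2] vertices are excluded here, which is the source of the bound
   [18 * k + 3]. *)
have [v2 v2C] : exists2 w, w \in C & w \notin v0 |: (v1 |: (bad v0 :|: bad v1)).
  apply: pick; rewrite !cardsU1.
  have := cbad v0 v0C; have := cbad v1 v1C; have [] := leq_card_setU (bad v0) (bad v1); lia.
rewrite !finset.in_setU1 finset.in_setU !negb_or => /and4P[v20 v21 bad02 bad12].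
pose v (j : 'I_3) := nth v0 [:: v0; v1; v2] j.
have vC j : v j \in C by case: j => -[|[|[|]]].
have hv i j : h i != v j.
  by apply: contraTneq (Ce i _ (vC j)) => ->; rewrite eirr.
have vinj : injective v.
  move=> i j /eqP; rewrite nth_uniq //= ?inE ?negb_or.
    by move=> /eqP/val_inj.
  by rewrite eq_sym v10 eq_sym v20 eq_sym v21.
have nbad (j j' : 'I_3) : (j < j')%N -> v j' \notin bad (v j).
  by case: j j' => -[|[|[|]]] // ? [] [|[|[|]]].
have ncr (i j i' j' : 'I_3) : (j < j')%N -> ~ crossing c [set h i; v j] [set h i'; v j'].
  move=> jj' cr; move: (nbad _ _ jj'); apply/negP/negPn.
  apply/bigcupP; exists (i, i') => //=; rewrite finset.in_set vC /= finset.in_set edge ?vC //=.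
  apply/andP; split; last exact/asboolP.
  apply/negP => /eqP /setP /(_ (v j')); rewrite !inE eqxx orbT => /esym/orP[] /eqP E.
    by move: (hv i j'); rewrite E eqxx.
  by move: jj'; rewrite (vinj _ _ E) ltnn.
apply: (no_uncrossed_K33 dr hinj vinj hv) => [i j|i j i' j' ii' jj']; first exact: Ce.
case: (ltngtP j j') => [lt|gt|/val_inj E]; first exact: ncr.
  by move=> /crossing_sym; exact: ncr.
by move: jj'; rewrite E eqxx.
Qed.

(** * Subharmonic vectors on graphs without K_{3,r} *)

Section Adjacency.
Variables (R : realFieldType) (T : finType) (e : rel T).
Hypotheses (e_sym : symmetric e) (e_irr : irreflexive e).

Definition adj (x z : T) : R := (e x z)%:R.
Definition deg (x : T) : R := \sum_z adj x z.

Lemma adjC x z : adj x z = adj z x. Proof. by rewrite /adj e_sym. Qed.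
Lemma adj_ge0 x z : 0 <= adj x z. Proof. exact: ler0n. Qed.
Lemma adj_le1 x z : adj x z <= 1. Proof. by rewrite /adj lern1 leq_b1. Qed.
Lemma adjxx x : adj x x = 0. Proof. by rewrite /adj e_irr. Qed.
Lemma adj01 x z : adj x z = 0 \/ adj x z = 1.
Proof. by rewrite /adj; case: (e x z); [right|left]. Qed.
Lemma deg_ge0 x : 0 <= deg x. Proof. by apply: sumr_ge0 => z _; exact: adj_ge0. Qed.

Lemma sum_mono (P : pred T) (f g : T -> R) : (forall x, 0 <= f x) ->
  (forall x, P x -> f x <= g x) -> (forall x, 0 <= g x) ->
  \sum_(x | P x) f x <= \sum_x g x.
Proof.
move=> f0 fg g0; rewrite [leRHS](bigID P) /=.
by apply: le_trans (ler_sum _ fg) _; rewrite lerDl sumr_ge0.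
Qed.

Lemma sum_adj_le (P : pred T) x (f : T -> R) : (forall z, 0 <= f z) ->
  \sum_(z | P z) adj x z * f z <= \sum_(z | P z) f z.
Proof.
by move=> f0; apply: ler_sum => z _; rewrite ler_piMl // adj_le1.
Qed.

Section Subharmonic.
Variables (y : T -> R) (theta : R) (M : R).
Hypotheses (y_ge0 : forall x, 0 <= y x) (y_le1 : forall x, y x <= 1).
Hypothesis theta_gt0 : 0 < theta.
Hypothesis y_sub : forall x, theta * y x <= \sum_z adj x z * y z.
Hypothesis sum_deg : \sum_x deg x = 2 * M.
Hypothesis M_theta : M <= theta ^+ 2.

Lemma subharmonic2 w :
  theta ^+ 2 * y w <= \sum_v adj w v * \sum_z adj v z * y z.
Proof.
rewrite expr2 -mulrA.
apply: le_trans (_ : theta * (\sum_z adj w z * y z) <= _).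
  by rewrite ler_wpM2l // ltW.
rewrite mulr_sumr; apply: ler_sum => v _.
by rewrite mulrCA ler_wpM2l ?adj_ge0.
Qed.

(** Walks of length two from [w] are determined by their second step, so at most [2 * M] of them end
    outside [D], each with weight at most [eta]. *)
Lemma subharmonic2_split (D : {set T}) eta w : 0 <= eta ->
  (forall z, z \notin D -> y z <= eta) ->
  theta ^+ 2 * y w <=
    \sum_v adj w v * (\sum_(z in D) adj v z * y z) + 2 * eta * M.
Proof.
move=> eta0 small; apply: le_trans (subharmonic2 w) _.
have -> : 2 * eta * M = \sum_x eta * deg x by rewrite -mulr_sumr sum_deg; ring.
apply: le_trans (_ : \sum_v adj w v * (\sum_(z in D) adj v z * y z + eta * deg v) <= _).
  apply: ler_sum => v _; rewrite ler_wpM2l ?adj_ge0 //.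
  rewrite (bigID (mem D)) /= lerD2l /deg mulr_sumr.
  apply: sum_mono => [x|x xD|x]; rewrite ?mulr_ge0 ?adj_ge0 //.
  by rewrite mulrC ler_wpM2r ?adj_ge0 ?small.
under eq_bigr do rewrite mulrDr.
rewrite big_split /= lerD2l; apply: sum_adj_le => z.
by rewrite mulr_ge0 ?deg_ge0.
Qed.

(** Since [y] is at most 1, an entry at least [eta] forces degree at least [eta * theta]. As
    [theta ^+ 2] is at least [M], this leaves of order [sqrt M] large entries, few enough for the
    pair term of [walks_to_set] to be linear in [M]. *)
Lemma card_large eta : 0 < eta -> #|[set z | eta <= y z]|%:R * (eta * theta) <= 2 * M.
Proof.
move=> eta0; rewrite -sum_deg mulr_natl -sumr_const.
apply: sum_mono => [x|x|x]; [by rewrite mulr_ge0 ?ltW| |exact: deg_ge0].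
rewrite inE => h; apply: le_trans (_ : theta * y x <= _).
  by rewrite mulrC ler_wpM2l // ltW.
by apply: le_trans (y_sub x) _; apply: ler_sum => z _; rewrite ler_piMr ?adj_ge0.
Qed.

Variable r : R.
Hypothesis r_ge0 : 0 <= r.
Hypothesis codeg3 : forall x1 x2 x3, x1 != x2 -> x1 != x3 -> x2 != x3 ->
  \sum_v adj x1 v * adj x2 v * adj x3 v <= r.

(* Pairs of elements of D have at most r common neighbours inside N(w), and
   s <= K + s (s - 1) / K trades the number of neighbours in D for that of pairs. *)
Lemma walks_to_set (D : {set T}) K w : 1 <= K ->
  \sum_v adj w v * (\sum_(z in D) adj v z) <= (K + 1) * deg w + #|D|%:R ^+ 2 * r / K.
Proof.
move=> K1.
(* Removing [w] makes it and a pair from [D'] three distinct vertices, as [codeg3] requires; the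
   summand 1 in [K + 1] pays for [w]. *)
pose D' := D :\ w; pose s v := \sum_(z in D') adj v z.
have K0 : 0 < K by lra.
have sK v : s v <= K + (s v ^+ 2 - s v) / K.
  rewrite -(ler_pM2r K0) mulrDl divfK ?gt_eqF //.
  have := sqr_ge0 (s v - (K + 1) / 2); nra.
have s2 v : s v ^+ 2 - s v = \sum_(z in D') \sum_(z' in D' | z' != z) adj v z * adj v z'.
  rewrite expr2 {1}/s mulr_suml -{2}[s v]mul1r /s mulr_sumr -sumrB.
  apply: eq_bigr => z zD; rewrite mulr_sumr (bigD1 z) //= mul1r.
  by case: (adj01 v z) => ->; rewrite ?mulr0 ?mul0r ?mul1r; lra.
apply: le_trans (_ : \sum_v adj w v * (K + 1 + (s v ^+ 2 - s v) / K) <= _).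
  apply: ler_sum => v _; rewrite ler_wpM2l ?adj_ge0 //.
  apply: le_trans (_ : 1 + s v <= _); last by have := sK v; lra.
  case: (boolP (w \in D)) => wD.
    by rewrite (big_setD1 w wD) /= lerD2r adj_le1.
  rewrite /s; suff -> : D' = D by lra.
  by apply/setP => z; rewrite !inE; case: eqP => // ->; rewrite (negbTE wD).
under eq_bigr do rewrite mulrDr mulrA.
rewrite big_split /= -!mulr_suml mulrC lerD2l ler_pM2r ?invr_gt0 //.
under eq_bigr => v _ do rewrite s2 mulr_sumr.
rewrite exchange_big /=.
have cD : #|D'|%:R <= #|D|%:R :> R by rewrite ler_nat subset_leq_card ?subD1set.
apply: le_trans (_ : \sum_(z in D') #|D'|%:R * r <= _); last first.
  rewrite sumr_const -[leLHS]mulr_natl mulrA ler_wpM2r // expr2.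
  by apply: ler_pM => //; exact: ler0n.
apply: ler_sum => z zD.
under eq_bigr do rewrite mulr_sumr.
rewrite exchange_big /=.
apply: le_trans (_ : \sum_(z' in D' | z' != z) r <= _); last first.
  rewrite big_mkcondr mulr_natl -sumr_const; apply: ler_sum => z' _.
  by case: ifP.
apply: ler_sum => z' /andP[z'D zz'].
apply: le_trans _ (codeg3 (x1 := w) (x2 := z) (x3 := z') _ _ _).
- by apply: ler_sum => v _; rewrite -mulrA (adjC v z) (adjC v z').
- by move: zD; rewrite !inE eq_sym => /andP[].
- by move: z'D; rewrite !inE eq_sym => /andP[].
- by rewrite eq_sym.
Qed.

(** Of a total of at least [c * M], entries below [eta = c / 8] account for at most [c / 4 * M]. So
    does the pair term, because [#|D|%:R ^+ 2 * c ^+ 2 <= 256 * M] and 1024 is 4 times 256. Half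
    remains for [(K + 1) * deg w]. *)
Lemma large_deg (c K : R) w : 0 < M -> 0 < c -> 1 <= K ->
  1024 * r <= K * c ^+ 3 ->
  c <= y w -> c / (2 * (K + 1)) * M <= deg w.
Proof.
move=> M0 c0 K1 hK yw.
have K0 : 0 < K by lra.
have [eta eta0 eta_def] : exists2 eta, 0 < eta & eta = c / 8 by exists (c / 8); lra.
pose D := [set z | eta <= y z].
have hD := card_large eta0; rewrite -/D in hD.
have D0 : 0 <= #|D|%:R :> R by exact: ler0n.
have D2 : #|D|%:R ^+ 2 * eta ^+ 2 <= 4 * M.
  rewrite -(ler_pM2r M0).
  apply: le_trans (_ : (#|D|%:R * (eta * theta)) ^+ 2 <= _).
    by rewrite !exprMn mulrA ler_wpM2l // mulr_ge0 ?sqr_ge0.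
  apply: le_trans (_ : (2 * M) ^+ 2 <= _); last by nra.
  by rewrite ler_sqr ?nnegrE // ?mulr_ge0 // ?ltW.
have walk : theta ^+ 2 * y w <= (K + 1) * deg w + #|D|%:R ^+ 2 * r / K + 2 * eta * M.
  apply: le_trans (subharmonic2_split (D := D) (eta := eta) w (ltW eta0) _) _.
    by move=> z; rewrite inE -ltNge => /ltW.
  rewrite lerD2r; apply: le_trans _ (walks_to_set D w K1).
  apply: ler_sum => v _; rewrite ler_wpM2l ?adj_ge0 //.
  by apply: ler_sum => z _; rewrite ler_piMr ?adj_ge0.
have rD : #|D|%:R ^+ 2 * r / K <= c / 4 * M.
  rewrite ler_pdivrMr //.
  have h1 : #|D|%:R ^+ 2 * c ^+ 2 <= 256 * M by move: D2; rewrite eta_def; nra.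
  rewrite -(ler_pM2r (exprn_gt0 2 c0)).
  have h2 : (#|D|%:R ^+ 2 * c ^+ 2) * r <= 256 * M * r by rewrite ler_wpM2r.
  have h3 : M * (1024 * r) <= M * (K * c ^+ 3) by rewrite (ler_wpM2l (ltW M0)).
  lra.
have h4 : c * M <= theta ^+ 2 * y w.
  by rewrite mulrC; apply: ler_pM => //; exact: ltW.
rewrite mulrAC ler_pdivrMr; last by lra.
rewrite eta_def in walk; nra.
Qed.

Lemma card_large_const (c c' : R) : 0 < M -> 0 < c' ->
  (forall w, c <= y w -> c' * M <= deg w) -> #|[set z | c <= y z]|%:R <= 2 / c'.
Proof.
move=> M0 c'0 h; rewrite ler_pdivlMr // -(ler_pM2r M0) -sum_deg -mulrA mulr_natl.
rewrite -sumr_const; apply: sum_mono => [x|x|x]; last exact: deg_ge0.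
  by rewrite mulr_ge0 ?ltW.
by rewrite inE; exact: h.
Qed.

(** An edge with a single end in [L] contributes once, so only edges inside [L] can push the sum
    above [M]. *)
Lemma sum_deg_set (L : {set T}) : \sum_(z in L) deg z <= M + #|L|%:R ^+ 2.
Proof.
have split x : deg x = \sum_(z in L) adj x z + \sum_(z | z \notin L) adj x z.
  by rewrite /deg (bigID (mem L)).
have e1 : 2 * M = \sum_(x in L) deg x + \sum_(x | x \notin L) deg x.
  by rewrite -sum_deg (bigID (mem L)).
have e2 : \sum_(x in L) deg x =
    \sum_(x in L) \sum_(z in L) adj x z + \sum_(x in L) \sum_(z | z \notin L) adj x z.
  by rewrite -big_split; apply: eq_bigr => x _; exact: split.
have e3 : \sum_(x in L) \sum_(z | z \notin L) adj x z <= \sum_(x | x \notin L) deg x.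
  rewrite exchange_big /=; apply: ler_sum => x _; rewrite split.
  under eq_bigr do rewrite adjC.
  by rewrite lerDl sumr_ge0 // => *; exact: adj_ge0.
have e4 : \sum_(x in L) \sum_(z in L) adj x z <= #|L|%:R ^+ 2.
  apply: le_trans (_ : \sum_(x in L) \sum_(z in L) (1 : R) <= _).
    by apply: ler_sum => x _; apply: ler_sum => z _; exact: adj_le1.
  by rewrite !sumr_const expr2 mulr_natr.
have e5 : 0 <= \sum_(x in L) \sum_(z in L) adj x z.
  by apply: sumr_ge0 => x _; apply: sumr_ge0 => z _; exact: adj_ge0.
lra.
Qed.

(** * The vertex of maximal entry: one hub or two hubs *)

Variable u : T.
Hypothesis y_u : y u = 1.

Definition codeg (x z : T) : R := \sum_v adj x v * adj v z.

Lemma codeg_ge0 x z : 0 <= codeg x z.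
Proof. by apply: sumr_ge0 => v _; rewrite mulr_ge0 ?adj_ge0. Qed.

Lemma codegxx x : codeg x x = deg x.
Proof.
by apply: eq_bigr => v _; rewrite (adjC v x); case: (adj01 x v) => ->; rewrite ?mulr0 ?mulr1.
Qed.

(** Walks from [u] into [L] have weight at least [(1 - 2 * c) * M], while the degrees in [L] sum to
    barely more than [M]. So few edges at [L] miss the neighbours of [u], and little weight is lost
    to entries below 1 ([outN], [loss]). *)
Lemma star_or_book (c l : R) (L : {set T}) : 0 < M -> 0 < c -> c <= 1 / 100 ->
  u \in L -> (forall z, z \notin L -> y z <= c) -> #|L|%:R <= l -> l ^+ 2 + l * r <= c * M ->
  (1 - 11 * c) * M <= deg u \/
  exists v, [/\ v != u, (1 - 17 * c) * M <= 2 * codeg u v & 1 - 12 * c <= y v].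
Proof.
move=> M0 c0 c1 uL small Ll lM.
have L0 : 0 <= #|L|%:R :> R by exact: ler0n.
have L2 : #|L|%:R ^+ 2 <= l ^+ 2 by rewrite ler_sqr ?nnegrE //; lra.
have Lr : #|L|%:R * r <= l * r by rewrite ler_wpM2r.
have Lr0 : 0 <= #|L|%:R * r by rewrite mulr_ge0.
have LL0 := sqr_ge0 (#|L|%:R : R).
pose dL x := \sum_(z in L) adj x z.
have dL0 x : 0 <= dL x by apply: sumr_ge0 => *; exact: adj_ge0.
have sum_dL : \sum_x dL x <= M + #|L|%:R ^+ 2.
  rewrite exchange_big /=; apply: le_trans (sum_deg_set L).
  by apply: ler_sum => z _; apply: ler_sum => x _; rewrite adjC.
have walk_u : M <= \sum_(z in L) codeg u z * y z + 2 * c * M.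
  have := subharmonic2_split u (ltW c0) small; rewrite y_u mulr1 => h.
  apply: le_trans M_theta (le_trans h _); rewrite lerD2r; under eq_bigr do rewrite mulr_sumr.
  rewrite exchange_big /= le_eqVlt; apply/orP; left; apply/eqP; apply: eq_bigr => z _.
  by rewrite mulr_suml; apply: eq_bigr => x _; rewrite mulrA.
have sum_codeg : \sum_(z in L) codeg u z = \sum_x adj u x * dL x.
  by rewrite exchange_big; apply: eq_bigr => x _; rewrite mulr_sumr.
have inN : \sum_x adj u x * dL x <= \sum_x dL x by exact: sum_adj_le.
have codeg_y : \sum_(z in L) codeg u z * y z <= \sum_(z in L) codeg u z.
  by apply: ler_sum => z _; rewrite ler_piMr ?codeg_ge0.
have outN : \sum_x (1 - adj u x) * dL x <= 2 * c * M + #|L|%:R ^+ 2.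
  under eq_bigr do rewrite mulrBl mul1r.
  by rewrite sumrB; lra.
have loss : \sum_(z in L) codeg u z * (1 - y z) <= 3 * c * M.
  under eq_bigr do rewrite mulrBr mulr1.
  by rewrite sumrB; lra.
have loss1 z : z \in L -> codeg u z * (1 - y z) <= 3 * c * M.
  move=> zL; apply: le_trans loss; rewrite (bigD1 z) //= lerDl.
  by apply: sumr_ge0 => x _; rewrite mulr_ge0 ?codeg_ge0 // subr_ge0.
(* A walk from [z] with its middle adjacent to [u] ends at [u], at [z], at a third vertex of [L]
   (few by [codeg3]), or at a small entry; middles not adjacent to [u] are bounded by [outN]. *)
have up z : z \in L -> z != u -> M * y z <= 2 * codeg u z + 5 * c * M.
  move=> zL zu.
  have zr : \sum_(z' in L | (z' != u) && (z' != z)) \sum_x adj u x * adj z x * adj z' x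
      <= #|L|%:R * r.
    apply: le_trans (_ : \sum_(z' in L | (z' != u) && (z' != z)) r <= _).
      by apply: ler_sum => z' /and3P[_ ? ?]; apply: codeg3; rewrite // eq_sym.
    by rewrite big_mkcondr mulr_natl -sumr_const; apply: ler_sum => z' _; case: ifP.
  have : theta ^+ 2 * y z <= \sum_x (1 - adj u x) * dL x + codeg u z * (1 + y z) +
      \sum_(z' in L | (z' != u) && (z' != z)) \sum_x adj u x * adj z x * adj z' x
      + 2 * c * M.
    apply: le_trans (subharmonic2_split z (ltW c0) small) _; rewrite lerD2r.
    rewrite exchange_big /= mulr_suml -!big_split /=; apply: ler_sum => x _.
    rewrite -mulr_sumr.
    have d1 : \sum_(z' in L) adj x z' * y z' <= dL x.
      by apply: ler_sum => z' _; rewrite ler_piMr ?adj_ge0.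
    have d0 : 0 <= \sum_(z' in L) adj x z' * y z'.
      by apply: sumr_ge0 => z' _; rewrite mulr_ge0 ?adj_ge0.
    have d2 : \sum_(z' in L) adj x z' * y z' <=
        adj x u + adj x z * y z + \sum_(z' in L | (z' != u) && (z' != z)) adj z' x.
      rewrite (bigD1 u) //= (bigD1 z) ?zL //= y_u mulr1 -addrA lerD2l lerD2l.
      rewrite (eq_bigl (fun z' => (z' \in L) && ((z' != u) && (z' != z)))); last first.
        by move=> z'; rewrite andbA.
      by apply: ler_sum => z' _; rewrite adjC ler_piMr ?adj_ge0.
    have n0 : 0 <= \sum_(z' in L | (z' != u) && (z' != z)) adj z' x.
      by apply: sumr_ge0 => *; exact: adj_ge0.
    move: d2; rewrite (adjC x u) (adjC x z) => d2.
    have yz := y_ge0 z; have dLx := dL0 x.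
    case: (adj01 u x) d2 => -> d2; case: (adj01 z x) d2 => -> d2; lra.
  have cy : codeg u z * y z <= codeg u z by rewrite ler_piMr ?codeg_ge0.
  have My : M * y z <= theta ^+ 2 * y z by rewrite ler_wpM2r.
  lra.
(* A codegree of at least [M / 4] forces [1 - y v <= 12 * c] through [loss1], and then nearly
   [M / 2] common neighbours through [up]. Below this threshold [up] gives [y z <= 1 / 2 + 5 * c],
   so [loss] bounds the codegrees and the walks must return to [u]. *)
case: (boolP [exists z in L, (z != u) && (M <= 4 * codeg u z)]) => [|none].
  move=> /existsP[v /andP[vL /andP[vu big]]]; right; exists v.
  have h1 := loss1 v vL; have h2 := up v vL vu; have yv := y_le1 v.
  have h3 : M * (1 - y v) <= 12 * c * M.
    apply: le_trans (_ : 4 * (codeg u v * (1 - y v)) <= _); last by lra.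
    by rewrite mulrA ler_wpM2r // subr_ge0.
  have h4 : 1 - y v <= 12 * c by rewrite -(ler_pM2r M0); lra.
  split=> //; [lra|lra].
left.
have rest : \sum_(z in L | z != u) codeg u z <= 9 * c * M.
  apply: le_trans (_ : 3 * \sum_(z in L) codeg u z * (1 - y z) <= _); last by lra.
  rewrite mulr_sumr [leRHS](bigD1 u) //= y_u subrr mulr0 mulr0 add0r.
  apply: ler_sum => z /andP[zL zu].
  have lt : 4 * codeg u z < M.
    by rewrite ltNge; apply: contra none => h; apply/existsP; exists z; rewrite zL zu.
  have h2 := up z zL zu.
  have h3 : y z <= 1 / 2 + 5 * c by rewrite -(ler_pM2r M0); lra.
  have h4 := codeg_ge0 u z; nra.
move: codeg_y; rewrite [leRHS](bigD1 u) //= codegxx; lra.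
Qed.

Lemma hub_bound (H : {set T}) w : w \notin H ->
  theta ^+ 2 * y w <= #|H|%:R * theta +
    (#|H|%:R + 1) * \sum_(x | x \notin H) \sum_(z | z \notin H) adj x z.
Proof.
move=> wH; set Q := \sum_(x | x \notin H) _.
have step x : theta * y x <= #|H|%:R + \sum_(z | z \notin H) adj x z * y z.
  apply: le_trans (y_sub x) _; rewrite (bigID (mem H)) /= lerD2r.
  rewrite -sumr_const; apply: ler_sum => z _; apply: mulr_ile1 => //.
  exact: adj_le1.
have rowQ : \sum_(z | z \notin H) adj w z <= Q.
  rewrite /Q [leRHS](bigD1 w) //= lerDl.
  by apply: sumr_ge0 => x _; apply: sumr_ge0 => *; exact: adj_ge0.
have h : theta * (\sum_(z | z \notin H) adj w z * y z) <= (#|H|%:R + 1) * Q.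
  rewrite mulr_sumr.
  apply: le_trans (_ : \sum_(v | v \notin H) adj w v *
    (#|H|%:R + \sum_(z | z \notin H) adj v z) <= _).
    apply: ler_sum => v _; rewrite mulrCA ler_wpM2l ?adj_ge0 //.
    apply: le_trans (step v) _; rewrite lerD2l; apply: ler_sum => z _.
    by rewrite ler_piMr ?adj_ge0.
  under eq_bigr do rewrite mulrDr.
  rewrite big_split /= mulrDl mul1r -mulr_suml mulrC lerD //.
    by rewrite ler_wpM2l ?ler0n.
  apply: sum_adj_le => z; apply: sumr_ge0 => *; exact: adj_ge0.
have := step w; rewrite -(ler_pM2l theta_gt0) mulrA -expr2 mulrDr [theta * _%:R]mulrC; lra.
Qed.

Lemma sum_deg_hub1 : 2 * M = 2 * deg u + \sum_(x | x != u) \sum_(z | z != u) adj x z.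
Proof.
rewrite -sum_deg (bigD1 u) //=.
have -> : \sum_(x | x != u) deg x =
    \sum_(x | x != u) adj u x + \sum_(x | x != u) \sum_(z | z != u) adj x z.
  by rewrite -big_split; apply: eq_bigr => x _; rewrite /deg (bigD1 u) //= adjC.
have -> : deg u = \sum_(x | x != u) adj u x by rewrite /deg (bigD1 u) //= adjxx add0r.
lra.
Qed.

(** Entries off [u] are at most 1/8 by [hub_bound], so the edges missing [u] add at most [Q / 8] to
    [deg u], less than their share [Q / 2] of [M]. *)
Lemma not_star : 64 <= theta -> M < theta ^+ 2 -> (1 - 1 / 800) * M <= deg u -> False.
Proof.
move=> t64 Mt du.
set Q := \sum_(x | x != u) \sum_(z | z != u) adj x z.
have eM : 2 * M = 2 * deg u + Q by exact: sum_deg_hub1.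
have y8 w : w != u -> y w <= 1 / 8.
  move=> wu; have := @hub_bound [set u] w; rewrite inE cards1 => /(_ wu).
  have -> : \sum_(x | x \notin [set u]) \sum_(z | z \notin [set u]) adj x z = Q.
    apply: eq_big => x; first by rewrite inE.
    by move=> _; apply: eq_bigl => z; rewrite inE.
  move=> h.
  rewrite -(ler_pM2l (exprn_gt0 2 theta_gt0)).
  have : 64 * theta <= theta ^+ 2 by rewrite expr2 ler_wpM2r // ltW.
  lra.
have : theta ^+ 2 * y u <= deg u + Q / 8.
  apply: le_trans (subharmonic2 u) _.
  have -> : deg u + Q / 8 = \sum_(v | v != u) (adj u v + (\sum_(z | z != u) adj v z) / 8).
    by rewrite big_split /= -mulr_suml; congr (_ + _); rewrite /deg (bigD1 u) //= adjxx add0r.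
  rewrite (bigD1 u) //= adjxx mul0r add0r; apply: ler_sum => v vu.
  rewrite (bigD1 u) //= y_u mulr1 (adjC v u).
  have h : \sum_(z | z != u) adj v z * y z <= (\sum_(z | z != u) adj v z) / 8.
    rewrite mulr_suml; apply: ler_sum => z zu; rewrite ler_wpM2l ?adj_ge0 //.
    by have := y8 z zu; lra.
  have h0 : 0 <= \sum_(z | z != u) adj v z * y z.
    by apply: sumr_ge0 => z _; rewrite mulr_ge0 ?adj_ge0.
  by case: (adj01 u v) => ->; lra.
have Q0 : 0 <= Q by apply: sumr_ge0 => x _; apply: sumr_ge0 => *; exact: adj_ge0.
rewrite y_u; lra.
Qed.

Definition priv (x z : T) : R := \sum_(w | (w != x) && (w != z)) adj x w * (1 - adj z w).

Lemma sum_off_pair (f : T -> R) x z : x != z ->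
  \sum_w f w = f x + f z + \sum_(w | (w != x) && (w != z)) f w.
Proof. by move=> xz; rewrite (bigD1 x) //= (bigD1 z) ?addrA // eq_sym. Qed.

Lemma deg_pair x z : x != z -> deg x = adj x z + codeg x z + priv x z.
Proof.
move=> xz; rewrite /deg /codeg (sum_off_pair _ xz) [in RHS](sum_off_pair _ xz) !adjxx.
rewrite mul0r mulr0 !add0r -addrA -big_split /=; congr (_ + _).
by apply: eq_bigr => w _; rewrite (adjC w z); ring.
Qed.

Lemma sum_deg_pair v : u != v ->
  M = adj u v + 2 * codeg u v + priv u v + priv v u +
    (\sum_(x | (x != u) && (x != v)) \sum_(z | (z != u) && (z != v)) adj x z) / 2.
Proof.
move=> uv; have vu : v != u by rewrite eq_sym.
set Q := \sum_(x | _) _.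
have eQ : \sum_(x | (x != u) && (x != v)) deg x =
    \sum_(x | (x != u) && (x != v)) adj u x + \sum_(x | (x != u) && (x != v)) adj v x + Q.
  rewrite -!big_split; apply: eq_bigr => x _.
  by rewrite {1}/deg (sum_off_pair _ uv) (adjC x u) (adjC x v).
have := sum_deg; rewrite (sum_off_pair _ uv) eQ.
have eu : deg u = adj u v + \sum_(x | (x != u) && (x != v)) adj u x.
  by rewrite {1}/deg (sum_off_pair _ uv) adjxx add0r.
have ev : deg v = adj u v + \sum_(x | (x != u) && (x != v)) adj v x.
  by rewrite {1}/deg (sum_off_pair _ uv) adjxx addr0 adjC.
have := deg_pair uv; have := deg_pair vu.
have -> : codeg v u = codeg u v.
  by apply: eq_bigr => x _; rewrite mulrC (adjC v) (adjC u).
rewrite (adjC v u); lra.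
Qed.

(** An edge to a common neighbour brings the full weight [s = y u + y v], close to 2, to the walks
    from both hubs. A private edge brings only about 1 and an edge off the hubs at most 1/4, so the
    slack in [theta] permits very few of these. *)
Lemma book_rigid v : v != u -> 64 <= theta -> M - 3 / 2 <= theta ^+ 2 - theta ->
  (1 - 1 / 500) * M <= 2 * codeg u v -> 1 - 1 / 500 <= y v ->
  [/\ e u v, priv u v + priv v u < 2 &
      forall x z, x != u -> x != v -> z != u -> z != v -> ~~ e x z].
Proof.
move=> vu t64 Mt nM yv; have uv : u != v by rewrite eq_sym.
have eM := sum_deg_pair uv.
set Q := \sum_(x | _) _ in eM.
have Q0 : 0 <= Q by apply: sumr_ge0 => x _; apply: sumr_ge0 => *; exact: adj_ge0.
have priv_ge0 x z : 0 <= priv x z.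
  by apply: sumr_ge0 => w _; rewrite mulr_ge0 ?adj_ge0 // subr_ge0 adj_le1.
have pu := priv_ge0 u v; have pv := priv_ge0 v u; have b0 := adj_ge0 u v.
have y16 w : w != u -> w != v -> y w <= 1 / 16.
  move=> wu wv; have := @hub_bound [set u; v] w.
  rewrite !inE negb_or wu wv cards2 uv /= => /(_ isT).
  have -> : \sum_(x | x \notin [set u; v]) \sum_(z | z \notin [set u; v]) adj x z = Q.
    apply: eq_big => x; first by rewrite !inE negb_or.
    by move=> _; apply: eq_bigl => z; rewrite !inE negb_or.
  move=> h; rewrite -(ler_pM2l (exprn_gt0 2 theta_gt0)).
  have : 64 * theta <= theta ^+ 2 by rewrite expr2 ler_wpM2r // ltW.
  lra.
have [s sE] : exists s, s = y u + y v by exists (y u + y v).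
have yu1 := y_le1 v.
(* The subharmonic inequalities at the hubs are added and multiplied by [theta]; one more step at
   each outer vertex sorts the walks by its adjacency to [u] and [v]. *)
have main : (theta ^+ 2 - adj u v * theta) * s <=
    2 * codeg u v * s + priv u v * y u + priv v u * y v + Q / 8.
  have hu : theta * y u <= adj u v * y v + \sum_(x | (x != u) && (x != v)) adj u x * y x.
    by apply: le_trans (y_sub u) _; rewrite (sum_off_pair _ uv) adjxx mul0r add0r.
  have hv : theta * y v <= adj u v * y u + \sum_(x | (x != u) && (x != v)) adj v x * y x.
    by apply: le_trans (y_sub v) _; rewrite (sum_off_pair _ uv) adjxx mul0r addr0 (adjC v u).
  have hs : theta * s <= adj u v * s +
      \sum_(x | (x != u) && (x != v)) (adj u x + adj v x) * y x.
    under eq_bigr do rewrite mulrDl.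
    by rewrite big_split /= sE; lra.
  have := hs; rewrite -(ler_pM2l theta_gt0) mulrDr => hs'.
  have tail : theta * (\sum_(x | (x != u) && (x != v)) (adj u x + adj v x) * y x) <=
      2 * codeg u v * s + priv u v * y u + priv v u * y v + Q / 8.
    have -> : 2 * codeg u v * s + priv u v * y u + priv v u * y v + Q / 8 =
      \sum_(x | (x != u) && (x != v)) (2 * (adj u x * adj x v) * s +
        adj u x * (1 - adj v x) * y u + adj v x * (1 - adj u x) * y v +
        (\sum_(z | (z != u) && (z != v)) adj x z) / 8).
      rewrite !big_split /= -!mulr_suml -!mulr_sumr; congr (_ + _ + _ + _).
        congr (_ * _ * _); rewrite /codeg (sum_off_pair _ uv) !adjxx.
        by rewrite mul0r mulr0 !add0r.
      by congr (_ * _); apply: eq_bigl => x; rewrite andbC.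
    rewrite mulr_sumr; apply: ler_sum => x /andP[xu xv].
    have hx : theta * y x <= adj u x * y u + adj v x * y v +
        (\sum_(z | (z != u) && (z != v)) adj x z) / 16.
      apply: le_trans (y_sub x) _; rewrite (sum_off_pair _ uv) (adjC x u) (adjC x v) lerD2l.
      rewrite mulr_suml; apply: ler_sum => z /andP[zu zv]; rewrite ler_wpM2l ?adj_ge0 //.
      by have := y16 z zu zv; lra.
    have r0 : 0 <= \sum_(z | (z != u) && (z != v)) adj x z.
      by apply: sumr_ge0 => *; exact: adj_ge0.
    rewrite mulrCA (adjC x v) sE.
    by case: (adj01 u x) hx => ->; case: (adj01 v x) => -> hx; lra.
  rewrite mulrBl expr2; lra.
have s2 : s = 1 + y v by rewrite sE y_u.
rewrite y_u in main.
have [b|b] := adj01 u v; rewrite b in main eM.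
  (* Without the edge between the hubs the right side of [main] is at most [M * s], whereas
     [theta >= 64] gives [theta ^+ 2 >= M + 62]. *)
  exfalso.
  have h1 : (M + 62) * s <= theta ^+ 2 * s by apply: ler_wpM2r; lra.
  nra.
have euv : e u v by move: b; rewrite /adj; case: (e u v) => // /eqP; rewrite eq_sym oner_eq0.
have h1 : (M - 3 / 2) * s <= (theta ^+ 2 - 1 * theta) * s by apply: ler_wpM2r; lra.
(* After substituting [eM] the common neighbours cancel and the remaining slack is [s / 2], at most
   1; a private neighbour costs about [s - 1], a unit of [Q] about [s / 2 - 1 / 8]. *)
have h2 : (priv u v + priv v u) * 9 / 10 + Q * 8 / 10 <= 1 by nra.
split=> //; first lra.
move=> x z xu xv zu zv; apply/negP => exz.
have xz : x != z by apply: contraTneq exz => ->; rewrite e_irr.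
(* An edge off the hubs is counted from both ends in [Q], while [h2] leaves [Q] at most 5/4. *)
suff : 2 <= Q by lra.
have row w z' : z' != u -> z' != v -> e w z' ->
    1 <= \sum_(t | (t != u) && (t != v)) adj w t.
  move=> z'u z'v ewz; rewrite (bigD1 z') ?z'u //= {1}/adj ewz lerDl.
  by apply: sumr_ge0 => *; exact: adj_ge0.
have h3 := row x z zu zv exz; have h4 := row z x xu xv.
rewrite e_sym in exz; have {}h4 := h4 exz.
have h5 : \sum_(t | (t != u) && (t != v)) adj z t <=
    \sum_(i | [&& i != u, i != v & i != x]) \sum_(t | (t != u) && (t != v)) adj i t.
  rewrite [leRHS](bigD1 z) ?zu ?zv //=; last by rewrite eq_sym.
  rewrite lerDl; apply: sumr_ge0 => i _; apply: sumr_ge0 => *; exact: adj_ge0.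
rewrite /Q (bigD1 x) ?xu //=; under [X in _ <= _ + X]eq_bigl do rewrite -andbA.
lra.
Qed.

End Subharmonic.
End Adjacency.

Lemma book_structure (R : realFieldType) (r : R) : 0 <= r ->
  exists M0 : R, forall (T : finType) (e : rel T) (y : T -> R) (theta M : R),
    symmetric e -> irreflexive e -> M0 <= M -> 0 < theta ->
    M - 3 / 2 <= theta ^+ 2 - theta ->
    (forall x, 0 <= y x) -> (exists x, 0 < y x) ->
    (forall x, theta * y x <= \sum_z adj R e x z * y z) ->
    \sum_x deg R e x = 2 * M ->
    (forall x1 x2 x3, x1 != x2 -> x1 != x3 -> x2 != x3 ->
      \sum_v adj R e x1 v * adj R e x2 v * adj R e x3 v <= r) ->
    exists u v, [/\ u != v, e u v, priv R e u v + priv R e v u < 2,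
      (forall x z, x != u -> x != v -> z != u -> z != v -> ~~ e x z) &
      M = 1 + 2 * codeg R e u v + priv R e u v + priv R e v u].
Proof.
move=> r0.
(* With [c] equal to 1/10000, [11 * c] is below the 1/800 of [not_star], and [12 * c] and [17 * c]
   are below the 1/500 of [book_rigid]. *)
have [c c0 c1] : exists2 c : R, 0 < c & c = 1 / 100 * (1 / 100).
  by exists (1 / 100 * (1 / 100)); lra.
have c3 : 0 < c ^+ 3 by exact: exprn_gt0.
pose K := 1 + 1024 * r / c ^+ 3.
have K1 : 1 <= K.
  rewrite lerDl; apply: divr_ge0; last exact: ltW.
  by apply: mulr_ge0; [exact: ler0n|exact: r0].
have hK : 1024 * r <= K * c ^+ 3.
  by rewrite /K [leRHS]mulrDl (divfK (lt0r_neq0 c3)) lerDr mul1r; exact: ltW.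
pose c' := c / (2 * (K + 1)).
have c'0 : 0 < c' by apply: divr_gt0 => //; lra.
pose l := 2 / c'; have l0 : 0 < l by apply: divr_gt0.
pose M1 := (l ^+ 2 + l * r) / c.
have M10 : 0 <= M1.
  apply: divr_ge0; last exact: ltW.
  by apply: addr_ge0; [exact: sqr_ge0|apply: mulr_ge0 => //; exact: ltW].
(* [M1] absorbs the error terms of [star_or_book]; the summand [64 * 64] forces [theta >= 64]. *)
exists (M1 + 64 * 64) => T e y0 theta M e_sym e_irr hM t0 Mt y00 [x0 yx0] ysub0 sd cd.
have M0 : 0 < M by lra.
have t64 : 64 <= theta by rewrite leNgt; apply/negP => lt; nra.
have Mt2 : M < theta ^+ 2 by lra.
pose u := [arg max_(x > x0) y0 x]%O.
have umax x : y0 x <= y0 u by rewrite /u; case: arg_maxP => // i _; exact.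
have yu0 : 0 < y0 u by exact: lt_le_trans yx0 (umax x0).
pose y x := y0 x / y0 u.
have y_ge0 x : 0 <= y x by rewrite divr_ge0 // ltW.
have y_le1 x : y x <= 1 by rewrite ler_pdivrMr // mul1r.
have y_u : y u = 1 by rewrite /y divff ?gt_eqF.
have ysub x : theta * y x <= \sum_z adj R e x z * y z.
  rewrite /y; under eq_bigr do rewrite mulrA.
  by rewrite -mulr_suml mulrA ler_pM2r ?invr_gt0.
have ld w : c <= y w -> c' * M <= deg R e w.
  exact: (large_deg e_sym y_ge0 y_le1 t0 ysub sd (ltW Mt2) r0 cd M0 c0 K1 hK).
pose L := [set z | c <= y z].
have uL : u \in L by rewrite inE y_u; lra.
have small z : z \notin L -> y z <= c by rewrite inE -ltNge => /ltW.
have Ll : #|L|%:R <= l by exact: (card_large_const sd M0 c'0 ld).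
have lM : l ^+ 2 + l * r <= c * M.
  have : M1 <= M by lra.
  by rewrite /M1 ler_pdivrMr // [leRHS]mulrC.
have c100 : c <= 1 / 100 by lra.
case: (star_or_book e_sym y_ge0 y_le1 t0 ysub sd (ltW Mt2) r0 cd y_u M0 c0 c100 uL small Ll lM)
  => [star|[v [vu nv yv]]].
  exfalso; apply: (not_star e_sym e_irr y_ge0 y_le1 t0 ysub sd y_u t64 Mt2).
  by apply: le_trans star; apply: ler_wpM2r; lra.
have [] := book_rigid e_sym e_irr y_ge0 y_le1 t0 ysub sd y_u vu t64 Mt.
- by apply: le_trans nv; apply: ler_wpM2r; lra.
- lra.
move=> euv p2 off; exists u, v; have uv : u != v by rewrite eq_sym.
split=> //; have := sum_deg_pair e_sym e_irr sd uv.
have -> : adj R e u v = 1 by rewrite /adj euv.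
rewrite big1; last first.
  move=> x /andP[xu xv]; apply: big1 => z /andP[zu zv].
  by rewrite /adj (negbTE (off x z xu xv zu zv)).
lra.
Qed.

(** * Spectral radius *)

Lemma sum_adj_card (R : realFieldType) (T : finType) (P : pred T) :
  \sum_v (P v)%:R = #|[set v | P v]|%:R :> R.
Proof. by rewrite -natr_sum -sum1dep_card [in RHS]big_mkcond. Qed.

Lemma handshake (R : realFieldType) (T : finType) (e : rel T) :
  symmetric e -> irreflexive e -> \sum_x deg R e x = 2 * #|edge_set e|%:R.
Proof.
move=> es ei.
suff h : (\sum_(p : T * T | e p.1 p.2) 1 = #|edge_set e| * 2)%N.
  rewrite -natrM mulnC -h /deg pair_bigA /= natr_sum [RHS]big_mkcond /=.
  by apply: eq_bigr => p _; rewrite /adj; case: (e _ _).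
rewrite (partition_big (fun p : T * T => [set p.1; p.2]) (mem (edge_set e))) /=; last first.
  move=> [x z] /= exz; rewrite inE; apply/existsP; exists x; apply/existsP; exists z.
  by rewrite exz eqxx.
rewrite -sum_nat_const; apply: eq_bigr => E.
rewrite inE => /existsP[x /existsP[z /andP[exz /eqP->]]].
have xz : x != z by apply: contraTneq exz => ->; rewrite ei.
rewrite (eq_bigl (mem [set (x, z); (z, x)])); last first.
  move=> [a b] /=; rewrite !inE !xpair_eqE; apply/andP/orP.
    move=> [eab /eqP E2].
    have ab : a != b by apply: contraTneq eab => ->; rewrite ei.
    have : a \in [set x; z] by rewrite -E2 !inE eqxx.
    have : b \in [set x; z] by rewrite -E2 !inE eqxx orbT.
    rewrite !inE => /orP[] /eqP Eb /orP[] /eqP Ea; move: ab; rewrite Ea Eb !eqxx //= => _;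
    by [left|right].
  by move=> [/andP[/eqP-> /eqP->]|/andP[/eqP-> /eqP->]]; split;
    rewrite ?exz ?eqxx // 1?es // finset.setUC.
by rewrite sum1_card cards2 xpair_eqE (negbTE xz).
Qed.

Section Spectrum.
Variable R : rcfType.

Definition eigenpair (T : finType) (e : rel T) (mu : R) (x : T -> R) : Prop :=
  (forall t, \sum_z adj R e t z * x z = mu * x t) /\ exists t, x t != 0.

(** [eigenvalue] refers to row eigenvectors; symmetry turns them into functions on the vertices
    satisfying the usual neighbour sums. *)
Lemma eigenpairP (T : finType) (e : rel T) (mu : R) : symmetric e ->
  reflect (exists x, eigenpair e mu x) (root (char_poly (adj_mx R e)) mu).
Proof.
move=> es; rewrite -eigenvalue_root_char; apply: (iffP eigenvalueP).
  move=> [v vA v0]; exists (fun t => v 0 (enum_rank t)); split.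
    move=> t; have /matrixP /(_ 0 (enum_rank t)) := vA; rewrite !mxE => <-.
    rewrite (reindex _ (onW_bij _ (enum_rank_bij T))) /=; apply: eq_bigr => z _.
    by rewrite mxE !enum_rankK mulrC /adj es.
  have [j vj] : exists j, v 0 j != 0.
    by apply/existsP; apply: contraNT v0 => /existsPn h; apply/eqP/rowP => j;
      rewrite mxE; apply/eqP; move: (h j); rewrite negbK.
  by exists (enum_val j); rewrite enum_valK.
move=> [x [xA [t xt]]]; exists (\row_j x (enum_val j)).
  apply/rowP => j; rewrite !mxE -xA (reindex _ (onW_bij _ (enum_rank_bij T))) /=.
  by apply: eq_bigr => z _; rewrite !mxE enum_rankK mulrC /adj es.
apply: contraNneq xt => /rowP /(_ (enum_rank t)); rewrite !mxE enum_rankK => ->.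
by [].
Qed.

Lemma mem_rootsR (p : {poly R}) (x : R) : p != 0 -> (x \in rootsR p) = root p x.
Proof. by move=> p0; rewrite -(roots_on_rootsR p0). Qed.

Lemma char_poly_neq0 (n : nat) (A : 'M[R]_n) : char_poly A != 0.
Proof. exact/monic_neq0/char_poly_monic. Qed.

Lemma le_lambda (T : finType) (e : rel T) (mu : R) (x : T -> R) :
  symmetric e -> eigenpair e mu x -> `|mu| <= lambda R e.
Proof.
move=> es ex; apply: le_bigmax_seq => //; rewrite mem_rootsR ?char_poly_neq0 //.
by apply/eigenpairP => //; exists x.
Qed.

Lemma lambda_ge0 (T : finType) (e : rel T) : 0 <= lambda R e.
Proof. by rewrite /lambda /spec_rad; elim/big_ind: _ => // a b a0 b0; rewrite le_max a0. Qed.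

(** Positivity excludes the default 0 of the maximum in [spec_rad]. *)
Lemma lambda_attained (T : finType) (e : rel T) : symmetric e -> 0 < lambda R e ->
  exists mu x, `|mu| = lambda R e /\ eigenpair e mu x.
Proof.
move=> es l0.
have [mu mur mul] : exists2 mu, mu \in rootsR (char_poly (adj_mx R e)) & `|mu| = lambda R e.
  move: l0; rewrite /lambda /spec_rad; elim: (rootsR _) => [|a s IH].
    by rewrite big_nil ltxx.
  rewrite big_cons; case: (lerP `|a| (\big[Num.max/0]_(b <- s) `|b|)) => h.
    by move=> /IH[mu ms E]; exists mu; rewrite // inE ms orbT.
  by move=> _; exists a; rewrite ?mem_head.
move: mur; rewrite mem_rootsR ?char_poly_neq0 // => /(eigenpairP _ es)[x ex].
by exists mu, x.
Qed.

(** The absolute value of an eigenvector, by the triangle inequality; this serves in place of a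
    Perron vector, and [mu] may be negative. *)
Lemma lambda_subharmonic (T : finType) (e : rel T) : symmetric e -> 0 < lambda R e ->
  exists y : T -> R, [/\ forall x, 0 <= y x, exists x, 0 < y x &
    forall x, lambda R e * y x <= \sum_z adj R e x z * y z].
Proof.
move=> es /(lambda_attained es)[mu [x [<- [ex [t xt]]]]].
exists (fun z => `|x z|); split=> [z||z]; first exact: normr_ge0.
  by exists t; rewrite normr_gt0.
rewrite -normrM -ex; apply: le_trans (ler_norm_sum _ _ _) _.
by apply: ler_sum => w _; rewrite normrM (ger0_norm (adj_ge0 R e z w)).
Qed.

(** An eigenvector is pulled back along [f] and set to 0 on isolated vertices. It stays nonzero
    because a nonzero eigenvalue forces it to vanish on the isolated vertices of [e]. *)
Lemma iso_ni_lambda_le (T U : finType) (e : rel T) (h : rel U) :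
  symmetric e -> symmetric h -> iso_ni e h -> lambda R e <= lambda R h.
Proof.
move=> es hs [f [finj fni fsurj fadj]].
case: (ltrP 0 (lambda R e)) => [l0|l0]; last exact: le_trans l0 (lambda_ge0 h).
have [mu [x [mul [ex [t xt]]]]] := lambda_attained es l0.
rewrite -mul; apply: (@le_lambda U h mu (fun u => if Defs.isolated h u then 0 else x (f u))) => //.
have iso_e z w : Defs.isolated e z -> adj R e z w = 0 /\ adj R e w z = 0.
  by move=> /forallP/(_ w)/negbTE; rewrite /adj [e w z]es => ->.
have iso_h z w : Defs.isolated h z -> adj R h z w = 0 /\ adj R h w z = 0.
  by move=> /forallP/(_ w)/negbTE; rewrite /adj [h w z]hs => ->.
split; last first.
  have tni : ~~ Defs.isolated e t.
    apply/negP => it; have := ex t; rewrite big1 => [|z _]; last first.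
      by rewrite (iso_e t z it).1 mul0r.
    move=> /esym/eqP; rewrite mulf_eq0 (negbTE xt) orbF -normr_eq0 mul.
    by rewrite gt_eqF.
  by have [u ui fu] := fsurj t tni; exists u; rewrite (negbTE ui) fu.
move=> u; case: ifPn => iu.
  by rewrite mulr0 big1 // => z _; rewrite (iso_h u z iu).1 mul0r.
rewrite -ex (bigID (Defs.isolated h)) /= big1 ?add0r; last by move=> z ->; rewrite mulr0.
rewrite [RHS](bigID (Defs.isolated e)) /= [X in _ = X + _]big1 ?add0r; last first.
  by move=> z iz; rewrite (iso_e z (f u) iz).2 mul0r.
rewrite [RHS](eq_bigl (mem (f @: [set z | ~~ Defs.isolated h z]))); last first.
  move=> z; apply/idP/imsetP; first by move=> /fsurj[w wi <-]; exists w; rewrite ?inE.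
  by move=> [w + ->]; rewrite inE; exact: fni.
rewrite big_imset /=; last first.
  by move=> a b; rewrite !inE => ai bi; exact: finj.
apply: eq_big => z; rewrite ?inE // => iz.
by rewrite (negbTE iz) /adj fadj.
Qed.

Lemma iso_ni_sym (T U : finType) (e : rel T) (h : rel U) (u0 : U) :
  symmetric h -> iso_ni e h -> iso_ni h e.
Proof.
move=> hs [f [finj fni fsurj fadj]].
pose g t := odflt u0 [pick u | ~~ Defs.isolated h u && (f u == t)].
have gf t : ~~ Defs.isolated e t -> ~~ Defs.isolated h (g t) /\ f (g t) = t.
  move=> /fsurj[u ui fu]; rewrite /g; case: pickP => /= [w /andP[wi /eqP //]|/(_ u)].
  by rewrite ui fu eqxx.
exists g; split.
- by move=> a b /gf[_ ga] /gf[_ gb] gab; rewrite -ga -gb gab.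
- by move=> t /gf[].
- move=> u ui; exists (f u); first exact: fni.
  by have [gi fg] := gf _ (fni _ ui); apply: finj.
- by move=> a b /gf[ai ga] /gf[bi gb]; rewrite -fadj // ga gb.
Qed.

End Spectrum.

(** * The graph S_{2,m} *)

Lemma S2_rel_sym (m : nat) : symmetric (S2_rel m).
Proof. by move=> i j; rewrite /S2_rel orbC. Qed.

Lemma S2_s_le1 (m : nat) : (S2_s m <= 1)%N.
Proof. exact: leq_b1. Qed.

Lemma sum_S2_vert (R : rcfType) (m : nat) (G : nat -> R) (g : R) :
  (forall j, (2 <= j < S2_t m + 2)%N -> G j = g) ->
  \sum_(j < S2_t m + 2 + S2_s m) G j =
  G 0%N + G 1%N + (S2_t m)%:R * g + (S2_s m)%:R * G (S2_t m + 2)%N.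
Proof.
move=> hG; rewrite big_split_ord /=; congr (_ + _).
  move: hG; rewrite addn2 => hG; rewrite 2!big_ord_recl /= addrA; congr (_ + _).
  rewrite (eq_bigr (fun=> g)) => [|i _]; first by rewrite sumr_const card_ord mulr_natl.
  by rewrite hG // /bump /= !add1n !ltnS ltn_ord.
case: (S2_s m) (S2_s_le1 m) => [|[|//]] _; first by rewrite big_ord0 mul0r.
by rewrite big_ord1 /= addn0 mul1r.
Qed.

(** The hypotheses are the eigenvalue equations for a vector with value [x0] and [x1] on the hubs,
    [y] on the common neighbours and [z] on the pendant vertex. *)
Lemma le_lambda_S2 (R : rcfType) (m : nat) (mu x0 x1 y z : R) : x0 != 0 ->
  mu * x0 = x1 + (S2_t m)%:R * y + (S2_s m)%:R * z ->
  mu * x1 = x0 + (S2_t m)%:R * y -> mu * y = x0 + x1 -> mu * z = x0 ->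
  `|mu| <= lambda R (S2_rel m).
Proof.
move=> x00 e0 e1 ey ez.
pose X (i : nat) := if i == 0%N then x0 else if i == 1%N then x1
  else if (i < S2_t m + 2)%N then y else z.
apply: (@le_lambda R _ (S2_rel m) mu (fun i => X i)); first exact: S2_rel_sym.
have s1 := S2_s_le1 m.
have n0 : (0 < S2_t m + 2 + S2_s m)%N by rewrite addn2.
split; last by exists (Ordinal n0).
move=> i; have hi := ltn_ord i; move: hi.
rewrite /adj /S2_rel; move: (nat_of_ord i) => {}i hi.
have Xt : X (S2_t m + 2)%N = z by rewrite /X addn2 /= ltnn.
have Xm j : (2 <= j < S2_t m + 2)%N -> X j = y.
  by rewrite /X => /andP[j2 ->]; case: j j2 => [|[|j]].
pose adjacent j := S2_lt m i j || S2_lt m j i.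
have sumE (b : bool) : (forall j, (2 <= j < S2_t m + 2)%N -> adjacent j = b) ->
    \sum_(j < S2_t m + 2 + S2_s m) (adjacent j)%:R * X j =
    (adjacent 0%N)%:R * x0 + (adjacent 1%N)%:R * x1 + (S2_t m)%:R * (b%:R * y) +
    (S2_s m)%:R * ((adjacent (S2_t m + 2)%N)%:R * z).
  move=> hb; rewrite (@sum_S2_vert R m (fun j => (adjacent j)%:R * X j) (b%:R * y)) ?Xt //.
  by move=> j hj; rewrite hb // Xm.
have [i0|[i1|[im|[il sl]]]] : i = 0%N \/ i = 1%N \/ (2 <= i < S2_t m + 2)%N \/
    (i = (S2_t m + 2)%N /\ S2_s m = 1%N) by lia.
- rewrite (sumE true); last by move=> j; rewrite /adjacent /S2_lt i0; lia.
  have -> : adjacent 0%N = false by rewrite /adjacent /S2_lt i0; lia.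
  have -> : adjacent 1%N = true by rewrite /adjacent /S2_lt i0; lia.
  have -> : adjacent (S2_t m + 2)%N = (S2_s m == 1%N) by rewrite /adjacent /S2_lt i0; lia.
  rewrite i0 /X /= e0; case: (S2_s m) s1 => [|[|//]] _ /=; lra.
- rewrite (sumE true); last by move=> j; rewrite /adjacent /S2_lt i1; lia.
  have -> : adjacent 0%N = true by rewrite /adjacent /S2_lt i1; lia.
  have -> : adjacent 1%N = false by rewrite /adjacent /S2_lt i1; lia.
  have -> : adjacent (S2_t m + 2)%N = false by rewrite /adjacent /S2_lt i1; lia.
  rewrite i1 /X /= e1; lra.
- rewrite (sumE false); last by move=> j; rewrite /adjacent /S2_lt; lia.
  have -> : adjacent 0%N = true by rewrite /adjacent /S2_lt; lia.
  have -> : adjacent 1%N = true by rewrite /adjacent /S2_lt; lia.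
  have -> : adjacent (S2_t m + 2)%N = false by rewrite /adjacent /S2_lt; lia.
  rewrite Xm // ey /=; lra.
- rewrite (sumE false); last by move=> j; rewrite /adjacent /S2_lt; lia.
  have -> : adjacent 0%N = true by rewrite /adjacent /S2_lt; lia.
  have -> : adjacent 1%N = false by rewrite /adjacent /S2_lt; lia.
  have -> : adjacent (S2_t m + 2)%N = false by rewrite /adjacent /S2_lt; lia.
  rewrite il Xt ez /=; lra.
Qed.

(** For even [m - 1] an eigenvalue satisfies [mu ^+ 2 - mu = m - 1] exactly. For odd [m - 1] the
    number [a] with [a ^+ 2 - a = m - 3 / 2] lies to the left of a root of the quotient
    polynomial. *)
Lemma lambda_S2_ge (R : rcfType) (m : nat) : (0 < m)%N ->
  0 < lambda R (S2_rel m) /\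
  m%:R - 3 / 2 <= lambda R (S2_rel m) ^+ 2 - lambda R (S2_rel m).
Proof.
move=> m0.
have mE : m%:R = 2 * (S2_t m)%:R + (S2_s m)%:R + 1 :> R.
  have mN : (2 * S2_t m + S2_s m + 1)%N = m by rewrite /S2_t /S2_s; lia.
  by rewrite -[in LHS]mN natrD natrD natrM.
suff [mu mu1 [muE [x0 [x1 [y [z [? ? ? ? ?]]]]]]] : exists2 mu : R, 1 <= mu &
    m%:R - 3 / 2 <= mu ^+ 2 - mu /\ exists x0 x1 y z : R, [/\ x0 != 0,
    mu * x0 = x1 + (S2_t m)%:R * y + (S2_s m)%:R * z,
    mu * x1 = x0 + (S2_t m)%:R * y, mu * y = x0 + x1 & mu * z = x0].
  have := @le_lambda_S2 R m mu x0 x1 y z; rewrite ger0_norm; last by lra.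
  move=> /(_ _ _ _ _ _) le; have {}le : mu <= lambda R (S2_rel m) by exact: le.
  by split; [lra|nra].
have t0 : 0 <= (S2_t m)%:R :> R by exact: ler0n.
set t : R := (S2_t m)%:R in t0 mE *.
have : S2_s m = 0%N \/ S2_s m = 1%N by have := S2_s_le1 m; lia.
case=> sE; rewrite mE sE.
  pose d := Num.sqrt (1 + 8 * t).
  have d0 : 0 <= d by exact: sqrtr_ge0.
  have dE : d ^+ 2 = 1 + 8 * t by rewrite sqr_sqrtr //; lra.
  have d1 : 1 <= d by rewrite leNgt; apply/negP => lt; nra.
  have [mu muE] : exists mu, mu = (1 + d) / 2 by exists ((1 + d) / 2).
  have mu0 : mu != 0 by apply: lt0r_neq0; lra.
  exists mu; first by lra.
  split; first by nra.
  exists 1, 1, (2 / mu), (1 / mu).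
  have yE : mu * (2 / mu) = 2 by rewrite mulrC divfK.
  have zE : mu * (1 / mu) = 1 by rewrite mulrC divfK.
  move: (2 / mu) (1 / mu) yE zE => y z yE zE.
  have muy : mu = 1 + t * y.
    have muy0 : mu * (mu - 1 - t * y) = 0.
      have h := congr1 (fun q => t * q) yE; rewrite muE in h *; nra.
    by move: muy0 => /eqP; rewrite mulf_eq0 (negbTE mu0) /= => /eqP; lra.
  split; rewrite ?oner_neq0 //; lra.
pose d := Num.sqrt (8 * t + 3).
have d0 : 0 <= d by exact: sqrtr_ge0.
have dE : d ^+ 2 = 8 * t + 3 by rewrite sqr_sqrtr //; lra.
have d1 : 1 <= d by rewrite leNgt; apply/negP => lt; nra.
have [a aE] : exists a, a = (1 + d) / 2 by exists ((1 + d) / 2).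
have aq : a ^+ 2 = a + 2 * t + 1 / 2 by rewrite aE; nra.
have a1 : 1 <= a by lra.
have ab : a <= 2 * t + 4 by rewrite leNgt; apply/negP => lt; nra.
(* The characteristic polynomial of the quotient of S_{2,m} by its automorphisms;
   its value where x^2 - x = 2 t + 1/2 is -1/4. *)
pose p : {poly R} := 'X^4 - (2 + 2 * t)%:P * 'X^2 - (2 * t)%:P * 'X + t%:P.
have pE x : p.[x] = x ^+ 4 - (2 + 2 * t) * x ^+ 2 - 2 * t * x + t.
  by rewrite /p !hornerE.
have pa : p.[a] = - (1 / 4).
  have a3 : a ^+ 4 = (a + 2 * t + 1 / 2) ^+ 2 by rewrite -aq; ring.
  rewrite pE a3 aq; nra.
have pb : 0 <= p.[2 * t + 4].
  by rewrite pE; nra.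
have [|mu /andP[mua _] /eqP] := @poly_ivt R p a (2 * t + 4) ab; first by rewrite pa pb; lra.
rewrite pE => hf.
exists mu; first by lra.
split; first by nra.
have mm0 : mu * (mu + 1) != 0 by apply: lt0r_neq0; nra.
have mu0 : mu != 0 by apply: lt0r_neq0; lra.
(* Subtracting the hub equations gives [(mu + 1) * (x0 - x1) = z], and [z = 1 / mu] for [x0 = 1]; so
   [w] is the difference of the hub values. The remaining equation [e1] is the vanishing of [p] at
   [mu]. *)
have [w hw] : exists w, mu * (mu + 1) * w = 1.
  by exists (mu * (mu + 1))^-1; rewrite mulfV.
have [y hy] : exists y, mu * y = 2 - w by exists ((2 - w) / mu); rewrite mulrC divfK.
have e1 : mu * (1 - w) - 1 - t * y = 0.
  have h0 : (mu * (1 - w) - 1 - t * y) * (mu * (mu * (mu + 1))) = 0.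
    have h1 := congr1 (fun q => mu ^+ 2 * q) hw; have h2 := congr1 (fun q => t * q) hw.
    have h3 := congr1 (fun q => t * (mu * (mu + 1)) * q) hy.
    rewrite /= in h1 h2 h3; lra.
  by move: h0 => /eqP; rewrite mulf_eq0 mulf_eq0 (negbTE mu0) (negbTE mm0) !orbF => /eqP.
exists 1, (1 - w), y, ((mu + 1) * w); split; rewrite ?oner_neq0 //; lra.
Qed.

(** * Recognising S_{2,m} and comparing spectral radii *)

Definition common_nbrs (T : finType) (e : rel T) (x z : T) : {set T} :=
  [set w | e x w && e z w].

Definition private_nbrs (T : finType) (e : rel T) (x z : T) : {set T} :=
  [set w | [&& w != z, e x w & ~~ e z w]].

(** Listing [h0], [h1], the common neighbours and then the private one reproduces the vertex
    numbering of [S2_rel]; [lt] is the counterpart of [S2_lt]. *)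
Lemma book_iso_S2 (T : finType) (e : rel T) (h0 h1 : T) (m : nat) :
  symmetric e -> irreflexive e -> h0 != h1 -> e h0 h1 ->
  (forall x z, x != h0 -> x != h1 -> z != h0 -> z != h1 -> ~~ e x z) ->
  #|private_nbrs e h1 h0| = 0%N -> (#|private_nbrs e h0 h1| <= 1)%N ->
  m = (1 + 2 * #|common_nbrs e h0 h1| + #|private_nbrs e h0 h1|)%N ->
  iso_ni e (S2_rel m).
Proof.
move=> es ei h01 eh off p10 p01 mE.
set B := common_nbrs e h0 h1 in mE; set P := private_nbrs e h0 h1 in p01 mE.
have tE : S2_t m = #|B| by rewrite /S2_t mE; lia.
have sE : S2_s m = #|P| by rewrite /S2_s mE; lia.
pose lt x z := [|| (x == h0) && (z == h1), ((x == h0) || (x == h1)) && (z \in B)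
  | (x == h0) && (z \in P)].
have noB x : (x == h0) || (x == h1) -> (x \in B = false) * (x \in P = false).
  by move=> /orP[] /eqP->; rewrite !inE !ei ?eqxx ?andbF.
have sub1 z : z != h0 -> e h1 z -> e h0 z.
  move=> z0 e1; apply: contraPT p10 => e0; apply/eqP; rewrite -lt0n.
  by apply/card_gt0P; exists z; rewrite inE z0 e1.
have lt0 z : e h0 z = lt h0 z || lt z h0.
  rewrite /lt eqxx (negbTE h01) !(noB h0) ?eqxx //= !andbF !orbF !inE.
  by case: (eqVneq z h1) => [->|]; [rewrite eh|case: (e h0 z); case: (e h1 z)].
have lt1 z : e h1 z = lt h1 z || lt z h1.
  rewrite /lt eqxx [h1 == h0]eq_sym (negbTE h01) !(noB h1) ?eqxx ?orbT //=.
  rewrite !andbF !orbF andbT !inE.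
  case: (eqVneq z h0) => [->|z0]; first by rewrite es eh orbT.
  by rewrite orbF; case: (boolP (e h1 z)) => [/(sub1 z z0)->|]; rewrite ?andbF.
have ltE x z : e x z = lt x z || lt z x.
  case: (eqVneq x h0) => [->|x0]; first exact: lt0.
  case: (eqVneq x h1) => [->|x1]; first exact: lt1.
  case: (eqVneq z h0) => [->|z0]; first by rewrite es orbC lt0.
  case: (eqVneq z h1) => [->|z1]; first by rewrite es orbC lt1.
  by rewrite (negbTE (off x z x0 x1 z0 z1)) /lt !(negbTE x0, negbTE x1, negbTE z0, negbTE z1).
pose l := h0 :: h1 :: enum B ++ enum P.
have szl : size l = (S2_t m + 2 + S2_s m)%N.
  by rewrite /l /= size_cat -!cardE tE sE; lia.
have dBP x : x \in B -> x \notin P by rewrite !inE => /andP[-> ->]; rewrite !andbF.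
have ul : uniq l.
  rewrite /l /= inE !mem_cat !mem_enum !noB ?eqxx ?orbT // (negbTE h01) /=.
  rewrite cat_uniq !enum_uniq /= andbT; apply/hasPn => x.
  by rewrite !mem_enum; apply: contraL; exact: dBP.
pose f (i : S2_vert m) := nth h0 l i.
have il (i : S2_vert m) : (i < size l)%N by rewrite szl.
have f0 i : (f i == h0) = (i == 0 :> nat) by rewrite -(nth_uniq h0 (il i) _ ul).
have f1 i : (f i == h1) = (i == 1 :> nat) by rewrite -(nth_uniq h0 (il i) _ ul).
have fBP (i : S2_vert m) : (f i \in B) = (2 <= i < S2_t m + 2)%N /\
    (f i \in P) = (i == S2_t m + 2 :> nat)%N.
  have hi := ltn_ord i.
  case: (ltnP i 2) => i2.
    rewrite !noB ?f0 ?f1; [by split; lia|by lia|by lia].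
  rewrite /f /l; have -> : nat_of_ord i = (i - 2).+2 by lia.
  rewrite /= nth_cat -cardE; case: ltnP => iB.
    have iB' : nth h0 (enum B) (i - 2) \in B by rewrite -mem_enum mem_nth // -cardE.
    by rewrite iB' (negbTE (dBP _ iB')); split; lia.
  have iP : nth h0 (enum P) (i - 2 - #|B|) \in P by rewrite -mem_enum mem_nth // -cardE; lia.
  have iB' : nth h0 (enum P) (i - 2 - #|B|) \notin B by apply: contraL iP; exact: dBP.
  by rewrite iP (negbTE iB'); split; lia.
have fadj i j : e (f i) (f j) = S2_rel m i j.
  rewrite ltE /S2_rel /lt /S2_lt !f0 !f1 !(fBP _).1 !(fBP _).2.
  by have := ltn_ord i; have := ltn_ord j; have := S2_s_le1 m; lia.
have finj : injective f.
  by move=> i j /eqP; rewrite nth_uniq // => /eqP/val_inj.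
have fsurj x z : e x z -> exists i, f i = x.
  move=> exz; have xl : x \in l.
    rewrite /l !inE mem_cat !mem_enum; move: exz; rewrite ltE /lt.
    by case: (x == h0); case: (x == h1); case: (x \in B); case: (x \in P); rewrite ?andbF ?orbF.
  have ix : (index x l < S2_t m + 2 + S2_s m)%N by rewrite -szl index_mem.
  by exists (Ordinal ix); rewrite /f /= nth_index.
exists f; split.
- by move=> i j _ _; exact: finj.
- move=> i /forallPn[j /negPn hij]; apply/forallPn; exists (f j).
  by rewrite fadj hij.
- move=> x /forallPn[z /negPn exz]; have [i fi] := fsurj x z exz.
  have [j fj] : exists j, f j = z by apply: (fsurj z x); rewrite es.
  exists i => //; apply/forallPn; exists j; by rewrite -fadj fi fj negbK.
- by move=> i j _ _; exact: fadj.
Qed.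

Lemma codegE (R : realFieldType) (T : finType) (e : rel T) (x z : T) : symmetric e ->
  codeg R e x z = #|common_nbrs e x z|%:R.
Proof.
move=> es; rewrite /codeg -sum_adj_card; apply: eq_bigr => v _.
by rewrite /adj (es v z) -natrM mulnb.
Qed.

Lemma privE (R : realFieldType) (T : finType) (e : rel T) (x z : T) : irreflexive e ->
  priv R e x z = #|private_nbrs e x z|%:R.
Proof.
move=> ei; rewrite /priv -sum_adj_card big_mkcond; apply: eq_bigr => w _.
rewrite /adj; case: (eqVneq w x) => [->|_]; first by rewrite ei !andbF.
by case: (w != z); case: (e x w); case: (e z w) => /=; rewrite ?subr0 ?subrr ?mul0r ?mulr0 ?mulr1.
Qed.

(** The function [x ^+ 2 - x] increases from 1/2 on, and [3 <= c] keeps [a] beyond 1. *)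
Lemma sqr_sub_mono (R : realFieldType) (a b c : R) : 3 <= c -> 0 < a ->
  c - 3 / 2 <= a ^+ 2 - a -> a <= b -> c - 3 / 2 <= b ^+ 2 - b.
Proof.
move=> c3 a0 ca ab; have a1 : 1 <= a by rewrite leNgt; apply/negP => lt; nra.
nra.
Qed.

Theorem theorem1p15 (R : realType) (k : nat) : (1 <= k)%N ->
  exists M : nat, forall m : nat, (M <= m)%N ->
    forall (T : finType) (e : rel T),
      symmetric e -> irreflexive e ->
      #|edge_set e| = m ->
      k_planar R k e ->
      lambda R e <= lambda R (S2_rel m) /\
      (lambda R e = lambda R (S2_rel m) <-> iso_ni e (S2_rel m)).
Proof.
move=> _; have [M0 hM0] := @book_structure R (18 * k + 3)%:R (ler0n _ _).
exists (Num.bound `|M0|%R + 3)%N => m Mm T e es ei cardE kpl.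
have mM0 : M0 <= m%:R.
  apply: le_trans (ler_norm _) (le_trans (ltW (archi_boundP (normr_ge0 M0))) _).
  by rewrite ler_nat; apply: leq_trans Mm; exact: leq_addr.
have m3 : 3 <= m%:R :> R by rewrite ler_nat; lia.
have m0 : (0 < m)%N by lia.
have [l0 lS] := lambda_S2_ge R m0.
(* Both the inequality and its equality case follow from this implication and the invariance
   [isoE]. *)
have isoP : lambda R (S2_rel m) <= lambda R e -> iso_ni e (S2_rel m).
  move=> le; have le0 := lt_le_trans l0 le.
  have [y [y0 yx ysub]] := lambda_subharmonic es le0.
  have leq : m%:R - 3 / 2 <= lambda R e ^+ 2 - lambda R e.
    exact: sqr_sub_mono m3 l0 lS le.
  have sd : \sum_x deg R e x = 2 * m%:R by rewrite handshake // cardE.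
  have [|u [v [uv euv p2 off mE]]] := hM0 T e y _ _ es ei mM0 le0 leq y0 yx ysub sd.
    move=> x1 x2 x3 x12 x13 x23.
    have -> : \sum_v adj R e x1 v * adj R e x2 v * adj R e x3 v =
        #|[set v | [&& e x1 v, e x2 v & e x3 v]]|%:R.
      by rewrite -sum_adj_card; apply: eq_bigr => v _; rewrite /adj -!natrM !mulnb andbA.
    by rewrite ler_nat ltnW // (k_planar_codegree3 ei kpl).
  move: p2 mE; rewrite (codegE R _ _ es) !(privE R _ _ ei) -natrD ltr_nat => p2 mE.
  have {}mE : m = (1 + 2 * #|common_nbrs e u v| + #|private_nbrs e u v| +
      #|private_nbrs e v u|)%N.
    by apply/eqP; rewrite -(eqr_nat R) mE natrD natrD natrD natrM.
  (* The private counts are integers with sum below 2, so one of them vanishes; the hubs are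
     exchanged if it is that of [u]. *)
  have [p0|p0] : #|private_nbrs e v u| = 0%N \/ #|private_nbrs e u v| = 0%N by lia.
    by apply: (book_iso_S2 es ei uv euv off p0); lia.
  apply: (@book_iso_S2 _ _ v u) => //; rewrite 1?eq_sym 1?es //.
  - by move=> *; exact: off.
  - lia.
  - suff -> : common_nbrs e v u = common_nbrs e u v by lia.
    by apply/setP => w; rewrite !inE andbC.
have isoE : iso_ni e (S2_rel m) -> lambda R e = lambda R (S2_rel m).
  move=> iso; have n0 : (0 < S2_t m + 2 + S2_s m)%N by rewrite addn2.
  apply/eqP; rewrite eq_le !iso_ni_lambda_le //; try exact: S2_rel_sym.
  exact: (iso_ni_sym (Ordinal n0) (@S2_rel_sym m) iso).
split; last by split=> [E|]; [apply: isoP; rewrite E|exact: isoE].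
(* A strict excess would make the graphs isomorphic by [isoP], hence their spectral radii equal. *)
rewrite leNgt; apply/negP => lt.
by move: (lt); rewrite (isoE (isoP (ltW lt))) ltxx.
Qed.
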